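(* Let $\mathbf{A}_1\in\mathbb{H}^{m\times n}_{r_1}$, $\mathbf{A}_2\in\mathbb{H}^{m\times p}_{r_2}$, $\mathbf{B}_2\in\mathbb{H}^{q\times s}_{r_3}$, $\mathbf{C}\in\mathbb{H}^{m\times s}$, let $\mathbf{M}=\mathbf{R}_{A_1}\mathbf{A}_2$ and assume $\operatorname{rank}\mathbf{M}=\min\{\operatorname{rank}\mathbf{A}_2,\operatorname{rank}\mathbf{R}_{A_1}\}=r_4$. Let $\mathbf{X}_1=\mathbf{A}_1^\dagger\mathbf{C}-\mathbf{A}_1^\dagger\mathbf{A}_2\mathbf{M}^\dagger\mathbf{C}=(x^{(1)}_{ij})\in\mathbb{H}^{n\times s}$ and $\mathbf{X}_2=\mathbf{M}^\dagger\mathbf{C}\mathbf{B}_2^\dagger=(x^{(2)}_{gf})\in\mathbb{H}^{p\times q}$. Let $\tilde{\mathbf{a}}^{(2)}_{.t}$ be the $t$th column of $\tilde{\mathbf{A}}_2=\mathbf{A}_1^*\mathbf{A}_2$, let $\mathbf{c}^{(1)}_{.j}$, $\mathbf{c}^{(2)}_{.j}$ be the $j$th columns of $\mathbf{C}_1=\mathbf{A}_1^*\mathbf{C}$ and $\mathbf{C}_2=\mathbf{M}^*\mathbf{C}$, and let $\mathbf{c}^{(3)}_{k.}$, $\mathbf{c}^{(3)}_{.l}$ be the $k$th row and $l$th column of $\mathbf{C}_3=\mathbf{M}^*\mathbf{C}\mathbf{B}_2^*$. Then $$x^{(1)}_{ij}=\frac{\sum_{\beta\in J_{r_1,n}\{i\}}\mathrm{cdet}_i\big((\mathbf{A}_1^*\mathbf{A}_1)_{.i}(\mathbf{c}^{(1)}_{.j})\big)^\beta_\beta}{\sum_{\beta\in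 J_{r_1,n}}|\mathbf{A}_1^*\mathbf{A}_1|^\beta_\beta}-\frac{\sum_{t=1}^p\sum_{\beta\in J_{r_1,n}\{i\}}\mathrm{cdet}_i\big((\mathbf{A}_1^*\mathbf{A}_1)_{.i}(\tilde{\mathbf{a}}^{(2)}_{.t})\big)^\beta_\beta\sum_{\beta\in J_{r_4,p}\{t\}}\mathrm{cdet}_t\big((\mathbf{M}^*\mathbf{M})_{.t}(\mathbf{c}^{(2)}_{.j})\big)^\beta_\beta}{\sum_{\beta\in J_{r_1,n}}|\mathbf{A}_1^*\mathbf{A}_1|^\beta_\beta\sum_{\beta\in J_{r_4,p}}|\mathbf{M}^*\mathbf{M}|^\beta_\beta},$$ and $$x^{(2)}_{gf}=\frac{\sum_{\beta\in J_{r_4,p}\{g\}}\mathrm{cdet}_g\big((\mathbf{M}^*\mathbf{M})_{.g}(\mathbf{d}^{B_2}_{.f})\big)^\beta_\beta}{\sum_{\beta\in J_{r_4,p}}|\mathbf{M}^*\mathbf{M}|^\beta_\beta\sum_{\alpha\in I_{r_3,q}}|\mathbf{B}_2\mathbf{B}_2^*|^\alpha_\alpha}=\frac{\sum_{\alpha\in I_{r_3,q}\{f\}}\mathrm{rdet}_f\big((\mathbf{B}_2\mathbf{B}_2^* )_{f.}(\mathbf{d}^{M}_{g.})\big)^\alpha_\alpha}{\sum_{\beta\in J_{r_4,p}}|\mathbf{M}^*\mathbf{M}|^\beta_\beta\sum_{\alpha\in I_{r_3,q}}|\mathbf{B}_2\mathbf{B}_2^*|^\alpha_\alpha},$$ where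 $\mathbf{d}^{B_2}_{.f}\in\mathbb{H}^{p\times1}$ has $k$th entry $\sum_{\alpha\in I_{r_3,q}\{f\}}\mathrm{rdet}_f\big((\mathbf{B}_2\mathbf{B}_2^* )_{f.}(\mathbf{c}^{(3)}_{k.})\big)^\alpha_\alpha$ ($k=1,\dots,p$) and $\mathbf{d}^{M}_{g.}\in\mathbb{H}^{1\times q}$ has $l$th entry $\sum_{\beta\in J_{r_4,p}\{g\}}\mathrm{cdet}_g\big((\mathbf{M}^*\mathbf{M})_{.g}(\mathbf{c}^{(3)}_{.l})\big)^\beta_\beta$ ($l=1,\dots,q$).
   Context: $\mathbb{H}$ is the skew field of real quaternions; $\mathbb{H}^{m\times n}$ is the set of $m\times n$ matrices over $\mathbb{H}$ and $\mathbb{H}^{m\times n}_r$ the subset of those of rank $r$. $\mathbf{A}^*$ is the conjugate transpose and $\mathbf{A}^\dagger$ the Moore–Penrose inverse (the unique $\mathbf{X}$ with $\mathbf{AXA}=\mathbf{A}$, $\mathbf{XAX}=\mathbf{X}$, $(\mathbf{AX})^*=\mathbf{AX}$, $(\mathbf{XA})^*=\mathbf{XA}$). $\mathbf{R}_A=\mathbf{I}-\mathbf{A}\mathbf{A}^\dagger$. For a matrix $\mathbf{F}$, $\mathbf{F}_{.j}(\mathbf{b})$ (resp. $\mathbf{F}_{i.}(\mathbf{b})$) is $\mathbf{F}$ with its $j$th column (resp. $i$th row) replaced by the column (resp. row) $\mathbf{b}$. Row/column determinants: for $\mathbf{F}=(a_{ij})\in\mathbb{H}^{n\times n}$, $\mathrm{rdet}_i\mathbf{F}=\sum_{\sigma\in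 S_n}(-1)^{n-r}(a_{i\,i_{k_1}}a_{i_{k_1}i_{k_1+1}}\cdots a_{i_{k_1+l_1}i})\cdots(a_{i_{k_r}i_{k_r+1}}\cdots a_{i_{k_r+l_r}i_{k_r}})$, where $\sigma=(i\,i_{k_1}\,i_{k_1+1}\cdots i_{k_1+l_1})(i_{k_2}\cdots i_{k_2+l_2})\cdots(i_{k_r}\cdots i_{k_r+l_r})$ is the decomposition of $\sigma$ into $r$ disjoint cycles (fixed points included) with $i_{k_2}<\cdots<i_{k_r}$ and $i_{k_t}<i_{k_t+s}$ for $t=2,\dots,r$, $s=1,\dots,l_t$; and $\mathrm{cdet}_j\mathbf{F}=\sum_{\tau\in S_n}(-1)^{n-r}(a_{j_{k_r}j_{k_r+l_r}}\cdots a_{j_{k_r+1}j_{k_r}})\cdots(a_{j\,j_{k_1+l_1}}\cdots a_{j_{k_1+1}j_{k_1}}a_{j_{k_1}j})$, where $\tau=(j_{k_r+l_r}\cdots j_{k_r+1}\,j_{k_r})\cdots(j_{k_2+l_2}\cdots j_{k_2})(j_{k_1+l_1}\cdots j_{k_1+1}\,j_{k_1}\,j)$ is the decomposition into $r$ disjoint cycles with $j_{k_2}<\cdots<j_{k_r}$ and $j_{k_t}<j_{k_t+s}$ for $t=2,\dots,r$, $s=1,\dots,l_t$. For Hermitian $\mathbf{F}$ all these coincide and are real; this value is $\det\mathbf{F}$. Index sets: $L_{k,n}$ is the set of strictly increasing sequences $\alpha=(\alpha_1<\cdots<\alpha_k)$ in $\{1,\dots,n\}$; $I_{k,m}\{i\}=\{\alpha\in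 L_{k,m}: i\in\alpha\}$, $J_{k,n}\{j\}=\{\beta\in L_{k,n}: j\in\beta\}$; sums over $J_{k,n}$ or $I_{k,m}$ without braces run over all of $L_{k,n}$, $L_{k,m}$. For a square $\mathbf{F}$, $\mathbf{F}^\alpha_\alpha$ is the principal submatrix with rows and columns indexed by $\alpha$; $\mathrm{cdet}_i(\mathbf{G})^\beta_\beta$ (resp. $\mathrm{rdet}_j(\mathbf{G})^\alpha_\alpha$) is the column (resp. row) determinant of the principal submatrix $\mathbf{G}^\beta_\beta$ taken at the column (resp. row) coming from index $i$ (resp. $j$); for Hermitian $\mathbf{F}$, $|\mathbf{F}|^\alpha_\alpha=\det\mathbf{F}^\alpha_\alpha$. *)

(* Defs.v *)
From HB Require Import structures.
From mathcomp Require Import all_boot all_order all_algebra all_fingroup.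
From mathcomp Require Import ring.
From mathcomp Require Import boolp reals.
From Stdlib Require Import ClassicalEpsilon.
Set Implicit Arguments.
Unset Strict Implicit.
Unset Printing Implicit Defensive.
Import Order.TTheory GRing.Theory Num.Theory.
Local Open Scope ring_scope.

Record quat (R : Type) := Quat { qre : R; qi : R; qj : R; qk : R }.
Arguments Quat {R}.

Section QuatEq.
Variable R : Type.
Definition seq_of_quat (x : quat R) := [:: qre x; qi x; qj x; qk x].
Definition quat_of_seq (s : seq R) :=
  if s is [:: a; b; c; d] then Some (Quat a b c d) else None.
Lemma seq_of_quatK : pcancel seq_of_quat quat_of_seq.
Proof. by case. Qed.
End QuatEq.

HB.instance Definition _ (R : eqType) := Equality.copy (quat R)
  (pcan_type (@seq_of_quatK R)).
HB.instance Definition _ (R : choiceType) := Choice.copy (quat R)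
  (pcan_type (@seq_of_quatK R)).

Section QuatRing.
Variable R : realType.
Local Notation H := (quat R).

Definition qadd (x y : H) :=
  Quat (qre x + qre y) (qi x + qi y) (qj x + qj y) (qk x + qk y).
Definition qopp (x : H) := Quat (- qre x) (- qi x) (- qj x) (- qk x).
Definition qzero : H := Quat 0 0 0 0.
Definition qone : H := Quat 1 0 0 0.
Definition qmul (x y : H) :=
  let: Quat a1 b1 c1 d1 := x in let: Quat a2 b2 c2 d2 := y in
  Quat (a1 * a2 - b1 * b2 - c1 * c2 - d1 * d2)
       (a1 * b2 + b1 * a2 + c1 * d2 - d1 * c2)
       (a1 * c2 - b1 * d2 + c1 * a2 + d1 * b2)
       (a1 * d2 + b1 * c2 - c1 * b2 + d1 * a2).

Lemma qaddA : associative qadd.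
Proof. by move=> [? ? ? ?] [? ? ? ?] [? ? ? ?]; rewrite /qadd /=; congr Quat; ring. Qed.
Lemma qaddC : commutative qadd.
Proof. by move=> [? ? ? ?] [? ? ? ?]; rewrite /qadd /=; congr Quat; ring. Qed.
Lemma qadd0 : left_id qzero qadd.
Proof. by move=> [? ? ? ?]; rewrite /qadd /=; congr Quat; ring. Qed.
Lemma qaddN : left_inverse qzero qopp qadd.
Proof. by move=> [? ? ? ?]; rewrite /qadd /=; congr Quat; ring. Qed.

HB.instance Definition _ := GRing.isZmodule.Build H qaddA qaddC qadd0 qaddN.

Lemma qmulA : associative qmul.
Proof. by move=> [? ? ? ?] [? ? ? ?] [? ? ? ?]; rewrite /qmul /=; congr Quat; ring. Qed.
Lemma qmul1 : left_id qone qmul.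
Proof. by move=> [? ? ? ?]; rewrite /qmul /=; congr Quat; ring. Qed.
Lemma qmulr1 : right_id qone qmul.
Proof. by move=> [? ? ? ?]; rewrite /qmul /=; congr Quat; ring. Qed.
Lemma qmulDl : left_distributive qmul qadd.
Proof. by move=> [? ? ? ?] [? ? ? ?] [? ? ? ?]; rewrite /qmul /= /qadd /=; congr Quat; ring. Qed.
Lemma qmulDr : right_distributive qmul qadd.
Proof. by move=> [? ? ? ?] [? ? ? ?] [? ? ? ?]; rewrite /qmul /= /qadd /=; congr Quat; ring. Qed.
Lemma qone_neq0 : qone != 0.
Proof. by apply/eqP => -[] /eqP; rewrite oner_eq0. Qed.

HB.instance Definition _ := GRing.Zmodule_isNzRing.Build H
  qmulA qmul1 qmulr1 qmulDl qmulDr qone_neq0.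

(* conjugation and inverse (q^-1 = conj q / |q|^2, and 0^-1 = 0) *)
Definition qconj (x : H) := Quat (qre x) (- qi x) (- qj x) (- qk x).
Definition qnorm2 (x : H) := qre x ^+ 2 + qi x ^+ 2 + qj x ^+ 2 + qk x ^+ 2.
Definition qinv (x : H) :=
  let c := (qnorm2 x)^-1 in
  Quat (c * qre x) (c * - qi x) (c * - qj x) (c * - qk x).
End QuatRing.

Section QMatrix.
Variable R : realType.
Local Notation H := (quat R).

Definition adjq m n (A : 'M[H]_(m, n)) : 'M[H]_(n, m) :=
  \matrix_(i, j) qconj (A j i).

Definition is_mpinv m n (A : 'M[H]_(m, n)) (X : 'M[H]_(n, m)) : Prop :=
  [/\ A *m X *m A = A, X *m A *m X = X,
      adjq (A *m X) = A *m X & adjq (X *m A) = X *m A].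

Definition mpinv m n (A : 'M[H]_(m, n)) : 'M[H]_(n, m) :=
  epsilon (inhabits 0) (is_mpinv A).

Definition RA m n (A : 'M[H]_(m, n)) : 'M[H]_m := 1%:M - A *m mpinv A.

(* rank over H: the maximal number of right-linearly independent columns *)
Definition indep_cols m n (A : 'M[H]_(m, n)) (k : nat) : Prop :=
  exists f : 'I_k -> 'I_n, forall c : 'cV[H]_k, colsub f A *m c = 0 -> c = 0.
Definition qrank m n (A : 'M[H]_(m, n)) : nat :=
  \max_(k < n.+1 | `[< indep_cols A k >]) k.

Definition colrep n k (F : 'M[H]_(k, n)) (j : 'I_n) (b : 'cV[H]_k) : 'M[H]_(k, n) :=
  \matrix_(a, c) if c == j then b a 0 else F a c.
Definition rowrep n k (F : 'M[H]_(n, k)) (i : 'I_n) (b : 'rV[H]_k) : 'M[H]_(n, k) :=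
  \matrix_(a, c) if a == i then b 0 c else F a c.

Definition cyc_prod n (F : 'M[H]_n) (s : 'S_n) (x : 'I_n) : H :=
  \prod_(k < #|porbit s x|) F ((s ^+ k)%g x) ((s ^+ k.+1)%g x).

Definition cyc_min n (s : 'S_n) (x : 'I_n) : bool :=
  [forall y in porbit s x, (x <= y)%N].

(* row determinant rdet_i: the cycle of i first (starting at i), then the
   other cycles in increasing order of their least elements, each
   starting at its least element; sign (-1)^(n - #cycles) *)
Definition rdet n (i : 'I_n) (F : 'M[H]_n) : H :=
  \sum_(s : 'S_n) (-1) ^+ (n - #|porbits s|) *
    (cyc_prod F s i *
     \prod_(x <- enum 'I_n | cyc_min s x && (i \notin porbit s x))
        cyc_prod F s x).

(* column determinant cdet_j: the other cycles in decreasing order of their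
   least elements (each starting at its least element), then the cycle of j
   starting at j *)
Definition cdet n (j : 'I_n) (F : 'M[H]_n) : H :=
  \sum_(s : 'S_n) (-1) ^+ (n - #|porbits s|) *
    (\prod_(x <- rev (enum 'I_n) | cyc_min s x && (j \notin porbit s x))
        cyc_prod F s x
     * cyc_prod F s j).

(* principal submatrix F^b_b, indices of b in increasing order *)
Definition psub n (F : 'M[H]_n) (b : {set 'I_n}) : 'M[H]_#|b| :=
  \matrix_(x, y) F (enum_val x) (enum_val y).

(* rdet_i (F)^b_b and cdet_i (F)^b_b, taken at the row/column coming from
   index i (meaningful for i \in b; 0 otherwise) *)
Definition rdet_sub n (F : 'M[H]_n) (b : {set 'I_n}) (i : 'I_n) : H :=
  match insub (index i (enum b)) : option 'I_#|b| with
  | Some i' => rdet i' (psub F b) | None => 0 end.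
Definition cdet_sub n (F : 'M[H]_n) (b : {set 'I_n}) (i : 'I_n) : H :=
  match insub (index i (enum b)) : option 'I_#|b| with
  | Some i' => cdet i' (psub F b) | None => 0 end.

(* determinant of a Hermitian matrix (all rdet_i / cdet_j coincide;
   we take rdet at the first index; the empty matrix has determinant 1) *)
Definition hdet n (F : 'M[H]_n) : H :=
  match insub 0%N : option 'I_n with Some i => rdet i F | None => 1 end.

Definition pminor n (F : 'M[H]_n) (b : {set 'I_n}) : H := hdet (psub F b).

End QMatrix.

(* Main.v *)
(** For a Hermitian matrix [H] and a set [b] of indices, let [mdet H b] be the
    Moore determinant of the principal submatrix [H_b], and [cof H b i y] the
    signed sum, over all simple paths from [i] to [y] inside [b], of the product
    of the entries of [H] along the path times the Moore determinant of [H] on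
    the rest of [b].  Removing the first vertex of the path gives a recursion on
    [b], by which [cof H b] is Hermitian, [mdet H b] is real and
    [cof H b * H_b = mdet H b * I].  The noncommutative column determinant with
    its [i]-th column replaced by a vector [v] is the sum of the
    [cof H b i y * v_y]: a permutation is its cycle through [i] and a permutation
    of the rest, and the latter contribute real, hence central, factors.

    Let [P_k] and [d_k] be the sums of [cof H b] and of [mdet H b] over all [b]
    of size [k].  Then [P_k H + P_(k+1) = d_k I].  For [H = A^* A] of rank [r] one
    has [d_k = 0] for [k > r] and [d_r > 0], so that [P_(r+1) H = 0] and
    [P_r H^2 = d_r H], which gives [P_r A^* = d_r A^+].  Both formulas for [X_1]
    and [X_2] follow from this identity and from its adjoint. *)
Require Import Defs.
From HB Require Import structures.
From mathcomp Require Import all_boot all_order all_algebra all_fingroup.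
From mathcomp Require Import ring lra.
From mathcomp Require Import boolp reals.
From Stdlib Require Import ClassicalEpsilon.
Set Implicit Arguments.
Unset Strict Implicit.
Unset Printing Implicit Defensive.
Import Order.TTheory GRing.Theory Num.Theory.
Local Open Scope ring_scope.

(** * Quaternions *)

Section Quaternions.
Variable R : realType.
Local Notation K := (quat R).
Implicit Types x y z : K.

Definition qreal (a : R) : K := Quat a 0 0 0.

Lemma qeqP x y :
  [/\ qre x = qre y, qi x = qi y, qj x = qj y & qk x = qk y] -> x = y.
Proof. by case: x y => ? ? ? ? [? ? ? ?] /= [-> -> -> ->]. Qed.

Lemma qconj_is_additive : {morph @qconj R : x y / x - y}.
Proof. by move=> [? ? ? ?] [? ? ? ?]; apply: qeqP; split=> /=; ring. Qed.
HB.instance Definition _ :=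
  GRing.isZmodMorphism.Build K K (@qconj R) qconj_is_additive.

Lemma qconjM x y : qconj (x * y) = qconj y * qconj x.
Proof. by case: x y => ? ? ? ? [? ? ? ?]; apply: qeqP; split=> /=; ring. Qed.

Lemma qconj1 : qconj 1 = 1 :> K.
Proof. by apply: qeqP; split=> //=; rewrite oppr0. Qed.

Lemma qconjK : involutive (@qconj R).
Proof. by case=> ? ? ? ?; rewrite /qconj /= !opprK. Qed.

Lemma qre_is_additive : {morph @qre R : x y / x - y}.
Proof. by move=> [? ? ? ?] [? ? ? ?]. Qed.
HB.instance Definition _ :=
  GRing.isZmodMorphism.Build K R (@qre R) qre_is_additive.

Lemma qreal_is_additive : {morph qreal : x y / x - y}.
Proof. by move=> a b; apply: qeqP; split=> //=; rewrite subr0. Qed.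
HB.instance Definition _ :=
  GRing.isZmodMorphism.Build R K qreal qreal_is_additive.

Lemma qrealM a b : qreal (a * b) = qreal a * qreal b.
Proof. by apply: qeqP; split=> /=; ring. Qed.

Lemma qreal_comm a x : qreal a * x = x * qreal a.
Proof. by case: x => ? ? ? ?; apply: qeqP; split=> /=; ring. Qed.

Lemma qconj_real a : qconj (qreal a) = qreal a.
Proof. by apply: qeqP; split=> //=; rewrite oppr0. Qed.

Lemma qconj_fixed x : qconj x = x -> x = qreal (qre x).
Proof. by case: x => a b c d [] hb hc hd; apply: qeqP; split=> //=; lra. Qed.

Lemma qreMC x y : qre (x * y) = qre (y * x).
Proof. by case: x y => ? ? ? ? [? ? ? ?] /=; ring. Qed.

Lemma qadd_conj x : x + qconj x = qreal (qre x *+ 2).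
Proof. by case: x => ? ? ? ?; apply: qeqP; split=> /=; ring. Qed.

Lemma qmul_conj x : x * qconj x = qreal (qnorm2 x).
Proof.
by case: x => ? ? ? ?; apply: qeqP; split=> /=; rewrite /qnorm2 /=; ring.
Qed.

Lemma qconj_mul x : qconj x * x = qreal (qnorm2 x).
Proof.
by case: x => ? ? ? ?; apply: qeqP; split=> /=; rewrite /qnorm2 /=; ring.
Qed.

Lemma qnorm2_ge0 x : 0 <= qnorm2 x.
Proof. by rewrite /qnorm2 !addr_ge0 // sqr_ge0. Qed.

Lemma qnorm2_eq0 x : (qnorm2 x == 0) = (x == 0).
Proof.
apply/idP/eqP => [|->]; last by rewrite /qnorm2 /= expr0n /= !addr0.
rewrite /qnorm2 !paddr_eq0 ?addr_ge0 ?sqr_ge0 // !sqrf_eq0.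
by move=> /andP[/andP[/andP[/eqP? /eqP?] /eqP?] /eqP?]; apply: qeqP; split.
Qed.

Lemma qinvE x : qinv x = qreal (qnorm2 x)^-1 * qconj x.
Proof. by case: x => ? ? ? ?; apply: qeqP; split=> /=; ring. Qed.

Lemma qmulV x : x != 0 -> x * qinv x = 1.
Proof.
move=> x0; rewrite qinvE mulrA -qreal_comm -mulrA qmul_conj -qrealM mulVf //.
by rewrite qnorm2_eq0.
Qed.

Lemma qmulVl x : x != 0 -> qinv x * x = 1.
Proof.
by move=> x0; rewrite qinvE -mulrA qconj_mul -qrealM mulVf // qnorm2_eq0.
Qed.

Lemma qmul_eq0 x y : x * y = 0 -> x != 0 -> y = 0.
Proof. by move=> xy0 /qmulVl xV; rewrite -[y]mul1r -xV -mulrA xy0 mulr0. Qed.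

Lemma qmul_eq0r x y : x * y = 0 -> y != 0 -> x = 0.
Proof. by move=> xy0 /qmulV yV; rewrite -[x]mulr1 -yV mulrA xy0 mul0r. Qed.

Lemma qinv_real a : a != 0 -> qinv (qreal a) = qreal a^-1.
Proof.
by move=> a0; apply: qeqP; split=> /=; rewrite /qnorm2 /=; field.
Qed.

Lemma qreal_inj : injective qreal.
Proof. by move=> a b []. Qed.

End Quaternions.

(** * Moore determinants and cofactors of Hermitian matrices *)

Section MooreDeterminant.
Variables (R : realType) (n : nat).
Local Notation K := (quat R).
Implicit Types (H : 'M[K]_n) (b : {set 'I_n}) (i j k x y z : 'I_n).

(* The index chosen by [pick] is immaterial when [H] is Hermitian: [moore_main]. *)
Definition mdet_of (N : 'I_n -> 'I_n -> K) H b : K :=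
  if [pick j in b] is Some j then \sum_(y in b) N j y * H y j else 1.

(* [d] is fuel, to be taken equal to [#|b|]. *)
Fixpoint cof_rec (d : nat) H b i y : K :=
  if d is d'.+1 then
    let N := cof_rec d' H (b :\ i) in
    (i == y)%:R * mdet_of N H (b :\ i) - \sum_(x in b :\ i) H i x * N x y
  else 0.

Definition cof H b := cof_rec #|b| H b.
Definition mdet H b := mdet_of (cof H b) H b.

Lemma cofE H b i y : i \in b ->
  cof H b i y = (i == y)%:R * mdet H (b :\ i)
                - \sum_(x in b :\ i) H i x * cof H (b :\ i) x y.
Proof. by move=> ib; rewrite /cof (cardsD1 i b) ib. Qed.

Lemma mdet0 H : mdet H set0 = 1.
Proof. by rewrite /mdet /mdet_of; case: pickP => // j; rewrite inE. Qed.

Lemma set_proper_ind (P : {set 'I_n} -> Prop) :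
  (forall b, (forall c : {set 'I_n}, c \proper b -> P c) -> P b) ->
  forall b, P b.
Proof.
move=> IH b; move: {2}#|b|.+1 (ltnSn #|b|) => d; elim: d b => // d IHd b hb.
by apply: IH => c /proper_card cb; apply: IHd; apply: leq_trans cb _.
Qed.

Lemma setD1_ind (P : {set 'I_n} -> Prop) :
  (forall b, (forall i, i \in b -> P (b :\ i)) -> P b) -> forall b, P b.
Proof.
move=> IH; apply: set_proper_ind => b IHb; apply: IH => i ib.
exact: IHb (properD1 ib).
Qed.

Lemma setD1C b i j : b :\ i :\ j = b :\ j :\ i.
Proof. by apply/setP => x; rewrite !inE andbCA. Qed.

(** A path inside [b] cannot end outside it. This lets sums over [b] be extended to all indices. *)
Lemma cof_notin H b i y : i \in b -> y \notin b -> cof H b i y = 0.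
Proof.
elim/setD1_ind: b i y => b IH i y ib yb; rewrite cofE //.
case: eqP => [iy|_]; first by rewrite -iy ib in yb.
rewrite mul0r big1 ?subrr // => x xb.
by rewrite (IH i) ?mulr0 // in_setD1 negb_and yb orbT.
Qed.

Lemma cof_diag H b i : i \in b -> cof H b i i = mdet H (b :\ i).
Proof.
move=> ib; rewrite cofE // eqxx mul1r big1 ?subr0 // => x xb.
by rewrite cof_notin ?mulr0 // !inE eqxx.
Qed.

(** Locality: it allows [H i k] and [H k i] to be altered without disturbing the cofactors of a set
    that omits [i] or [k]. *)
Lemma mdet_cof_eq H H' b :
  (forall x y, x \in b -> y \in b -> H x y = H' x y) ->
  mdet H b = mdet H' b /\ (forall x y, x \in b -> cof H b x y = cof H' b x y).
Proof.
elim/setD1_ind: b => b IH e.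
have ec x y : x \in b -> cof H b x y = cof H' b x y.
  move=> xb; have [| m_eq c_eq] := IH x xb.
    by move=> u v /setD1P[_ ub] /setD1P[_ vb]; apply: e.
  rewrite !cofE // m_eq; congr (_ - _); apply: eq_bigr => z zb.
  by rewrite c_eq // e //; case/setD1P: zb.
split=> //; rewrite /mdet /mdet_of; case: pickP => // j jb.
by apply: eq_bigr => y yb; rewrite ec ?e.
Qed.

Definition central (a : K) := forall c : K, a * c = c * a.

(* Paths are cut here at their last edge; the definition cuts at the first. *)
Lemma cof_col H b i y :
  (forall c : {set _}, c \proper b -> central (mdet H c)) ->
  i \in b -> y \in b -> i != y ->
  cof H b i y = - \sum_(z in b :\ y) cof H (b :\ y) i z * H z y.
Proof.
elim/setD1_ind: b i y => b IH i y cen ib yb iy.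
have iby : i \in b :\ y by rewrite !inE iy.
have ybi : y \in b :\ i by rewrite !inE eq_sym iy.
rewrite cofE // (negbTE iy) mul0r sub0r; congr (- _).
rewrite (bigD1 y) //= cof_diag //.
under [in RHS]eq_bigr => z _ do rewrite cofE // mulrBl.
rewrite sumrB [X in _ = X - _](bigD1 i) //= eqxx mul1r.
have -> : \sum_(z in b :\ y | z != i) (i == z)%:R * mdet H (b :\ y :\ i) * H z y
    = 0.
  by apply: big1 => z /andP[_]; rewrite eq_sym => /negbTE->; rewrite !mul0r.
(* The path with the single edge [H i y]: edge and determinant of the rest occur in opposite orders
   on the two sides, hence centrality. *)
rewrite addr0 setD1C cen; last first.
  by apply: (sub_proper_trans (subsetDl _ _)); apply: properD1.
congr (_ + _).
(* Longer paths lose both end edges: the last one by the induction hypothesis on the left, the first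
   one by definition on the right. *)
have -> : \sum_(x in b :\ i | x != y) H i x * cof H (b :\ i) x y
   = \sum_(x in b :\ y :\ i)
      - (\sum_(z in b :\ y :\ i) H i x * cof H (b :\ y :\ i) x z * H z y).
  apply: eq_big => [x|x]; first by rewrite !inE [RHS]andbCA andbC.
  case/andP=> xbi xy; rewrite (IH i) //; last first.
    by move=> c cb; apply: cen; apply: (proper_trans cb); apply: properD1.
  rewrite mulrN mulr_sumr [b :\ i :\ y]setD1C; congr (- _).
  by apply: eq_bigr => z _; rewrite mulrA.
rewrite sumrN exchange_big /=; congr (- _).
rewrite [RHS](bigD1 i) //= [X in _ = X + _](_ : _ = 0); last first.
  by rewrite big1 ?mul0r // => x xb; rewrite cof_notin ?mulr0 // !inE eqxx.
rewrite add0r; apply: eq_big => [x|x _]; first by rewrite !inE andbC.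
by rewrite mulr_suml.
Qed.

Definition hermitian H := adjq H = H.

Lemma hermitianP H : hermitian H <-> forall x y, qconj (H x y) = H y x.
Proof.
split=> [hH x y|hH]; first by rewrite -[in RHS]hH mxE.
by apply/matrixP => x y; rewrite mxE hH.
Qed.

Lemma qconj_nat (a : bool) (c : K) : qconj (a%:R * c) = a%:R * qconj c.
Proof. by case: a; rewrite ?mul1r // !mul0r raddf0. Qed.

Lemma qconj_sum (I : finType) (P : pred I) (F : I -> K) :
  qconj (\sum_(i | P i) F i) = \sum_(i | P i) qconj (F i).
Proof. exact: raddf_sum. Qed.

Lemma real_central (a : K) : qconj a = a -> central a.
Proof. by move=> /qconj_fixed-> x; rewrite qreal_comm. Qed.

(* The candidate for [mdet H b] obtained by expanding along [i]. *)
Definition mexp H b i := \sum_(y in b) cof H b i y * H y i.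

Lemma mexpE H b i : i \in b ->
  mexp H b i = mdet H (b :\ i) * H i i
   - \sum_(x in b :\ i) \sum_(y in b :\ i) H i x * cof H (b :\ i) x y * H y i.
Proof.
move=> ib; rewrite /mexp (bigD1 i) //= cof_diag //; congr (_ + _).
have -> : \sum_(y in b | y != i) cof H b i y * H y i =
  - \sum_(y in b :\ i) \sum_(x in b :\ i) H i x * cof H (b :\ i) x y * H y i.
  rewrite -sumrN; apply: eq_big => [y|y]; first by rewrite !inE andbC.
  case/andP=> yb yi; rewrite cofE // eq_sym (negbTE yi) mul0r sub0r mulNr.
  by rewrite mulr_suml.
by rewrite exchange_big.
Qed.

(* The entries H i k, H k i do not occur in the cofactors of b minus i or of b
   minus k: this isolates them in the two expansions. *)
Lemma mexp_split H b i k : i \in b -> k \in b -> i != k ->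
  let c := b :\ i :\ k in
  (forall c' : {set _}, c' \proper b -> central (mdet H c')) ->
  mexp H b i = mdet H (b :\ i) * H i i
   - \sum_(x in c) \sum_(y in c) H i x * cof H (b :\ i) x y * H y i
   - mdet H c * (H i k * H k i)
   + (H i k * (\sum_(x in c) \sum_(y in c) H k x * cof H c x y * H y i)
     + (\sum_(x in c) \sum_(y in c) H i x * cof H c x y * H y k) * H k i).
Proof.
move=> ib kb ik c cen; rewrite mexpE // -!addrA; congr (_ + _).
have kbi : k \in b :\ i by rewrite !inE eq_sym ik.
have cen' (c' : {set _}) : c' \proper b :\ i -> central (mdet H c').
  by move=> h; apply: cen; apply: (proper_trans h); apply: properD1.
have e P : \sum_(y in b :\ i) P y = P k + \sum_(y in c) P y :> K.
  rewrite (bigD1 k) //=; congr (_ + _); apply: eq_bigl => y.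
  by rewrite !inE andbC.
rewrite e [X in X + _]e cof_diag //.
have -> : \sum_(x in c) \sum_(y in b :\ i) H i x * cof H (b :\ i) x y * H y i
  = - (\sum_(x in c) \sum_(y in c) H i x * cof H c x y * H y k) * H k i
    + \sum_(x in c) \sum_(y in c) H i x * cof H (b :\ i) x y * H y i.
  under eq_bigr => x _ do rewrite e.
  rewrite big_split /=; congr (_ + _); rewrite mulNr mulr_suml -sumrN.
  apply: eq_bigr => x xc; have /setD1P[xk xbi] := xc.
  rewrite cof_col // mulrN mulNr mulr_sumr; congr (- (_ * _)).
  by apply: eq_bigr => z _; rewrite mulrA.
have -> : \sum_(y in c) H i k * cof H (b :\ i) k y * H y i =
  - (H i k * \sum_(x in c) \sum_(y in c) H k x * cof H c x y * H y i).
  rewrite exchange_big mulr_sumr -sumrN; apply: eq_bigr => y yc.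
  have /setD1P[yk ybi] := yc; rewrite cofE // eq_sym (negbTE yk) mul0r sub0r.
  by rewrite mulrN mulNr -mulrA mulr_suml.
have -> : H i k * mdet H c * H k i = mdet H c * (H i k * H k i).
  rewrite mulrA -cen //.
  by apply: (sub_proper_trans (subsetDl _ _)); apply: properD1.
rewrite mulNr !opprD !opprK addrA [LHS]addrC -[in LHS]addrA.
by rewrite addrC -!addrA.
Qed.

(** The properties are bundled because their inductive steps draw on one another for smaller
    sets. *)
Definition moore_good H b :=
  [/\ forall i k, i \in b -> k \in b ->
        \sum_(y in b) cof H b i y * H y k = (i == k)%:R * mdet H b,
      forall i y, i \in b -> y \in b -> qconj (cof H b i y) = cof H b y i
    & qconj (mdet H b) = mdet H b].

(** * Inductive step over the proper subsets of [b] *)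

Section Induction.
Variable b : {set 'I_n}.
(** The matrix is quantified here because [moore_main] passes from [H] to a modified matrix. *)
Hypothesis IH : forall H (c : {set 'I_n}),
  hermitian H -> c \proper b -> moore_good H c.

Lemma good_central H (c : {set 'I_n}) :
  hermitian H -> c \proper b -> central (mdet H c).
Proof. by move=> hH cb; have [_ _ /real_central] := IH hH cb. Qed.

Lemma cof_herm_step H i y : hermitian H -> i \in b -> y \in b ->
  qconj (cof H b i y) = cof H b y i.
Proof.
move=> hH ib yb; have [<-|iy] := eqVneq i y.
  by rewrite cof_diag //; have [] := IH hH (properD1 ib).
rewrite cof_col //; last by move=> c; apply: good_central.
rewrite cofE // eq_sym (negbTE iy) mul0r sub0r raddfN /= qconj_sum; congr (- _).
apply: eq_bigr => z zb; rewrite qconjM (hermitianP H).1 //.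
have [_ -> //] := IH hH (properD1 yb).
by rewrite !inE iy.
Qed.

(** After removal of the first edge, the hypothesis on [b :\ i] collapses the inner sums to the term
    [x = k], which cancels the diagonal term up to centrality. *)
Lemma cof_row_step H i k : hermitian H -> i \in b -> k \in b -> i != k ->
  \sum_(y in b) cof H b i y * H y k = 0.
Proof.
move=> hH ib kb ik; rewrite (bigD1 i) //= cof_diag //.
have kbi : k \in b :\ i by rewrite !inE eq_sym ik.
have -> : \sum_(y in b | y != i) cof H b i y * H y k =
   - \sum_(x in b :\ i) H i x * \sum_(y in b :\ i) cof H (b :\ i) x y * H y k.
  under [X in - X]eq_bigr => x _ do rewrite mulr_sumr.
  rewrite exchange_big -sumrN; apply: eq_big => [y|y]; first by rewrite !inE andbC.
  case/andP=> yb yi; rewrite cofE // eq_sym (negbTE yi) mul0r sub0r mulNr.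
  by rewrite mulr_suml; congr (- _); apply: eq_bigr => x _; rewrite mulrA.
have [eqs _ _] := IH hH (properD1 ib).
rewrite (bigD1 k) //= eqs // eqxx mul1r big1 => [|x /andP[xb /negbTE xk]].
  by rewrite addr0 (good_central hH (properD1 ib)) subrr.
by rewrite eqs // xk mul0r mulr0.
Qed.

Lemma mexp_real H i : hermitian H -> i \in b -> qconj (mexp H b i) = mexp H b i.
Proof.
move=> hH ib; have hE := (hermitianP H).1 hH.
have [_ herm re] := IH hH (properD1 ib).
rewrite mexpE // raddfB /= qconjM re hE -(good_central hH (properD1 ib)).
congr (_ - _); rewrite qconj_sum exchange_big; apply: eq_bigr => x xb.
rewrite qconj_sum; apply: eq_bigr => y yb.
by rewrite !qconjM !hE herm // mulrA.
Qed.

(** With [N] the cofactor matrix on [b], both [N H] and its adjoint [H N] are diagonal with entries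
    [mexp H b]; the two sides are the two ways of evaluating [H N H] at [(i, k)]. *)
Lemma mexp_comm H i k : hermitian H -> i \in b -> k \in b ->
  mexp H b i * H i k = H i k * mexp H b k.
Proof.
move=> hH ib kb; have hE := (hermitianP H).1 hH.
have NH x y : x \in b -> y \in b ->
    \sum_(z in b) cof H b x z * H z y = (x == y)%:R * mexp H b y.
  move=> xb yb; case: eqP => [->|/eqP xy]; first by rewrite mul1r.
  by rewrite mul0r cof_row_step.
have HN x y : x \in b -> y \in b ->
    \sum_(z in b) H x z * cof H b z y = (y == x)%:R * mexp H b x.
  move=> xb yb; have := congr1 (@qconj R) (NH y x yb xb).
  rewrite qconj_nat mexp_real // qconj_sum => <-.
  by apply: eq_bigr => z zb; rewrite qconjM hE cof_herm_step.
transitivity (\sum_(z in b) \sum_(y in b) H i y * cof H b y z * H z k).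
  rewrite (bigD1 i) //= -mulr_suml HN // eqxx mul1r big1 ?addr0 // => z.
  by case/andP=> zb zi; rewrite -mulr_suml HN // (negbTE zi) !mul0r.
rewrite exchange_big (bigD1 k) //= [X in _ + X]big1 ?addr0 => [|z /andP[zb zk]].
  by under eq_bigr => z _ do rewrite -mulrA; rewrite -mulr_sumr NH // eqxx mul1r.
under eq_bigr => y _ do rewrite -mulrA.
by rewrite -mulr_sumr NH // (negbTE zk) mul0r mulr0.
Qed.

End Induction.
End MooreDeterminant.

(** * Independence of the expansion index *)

Section MooreDeterminantTheory.
Variables (R : realType) (n : nat).
Local Notation K := (quat R).
Implicit Types (H : 'M[K]_n) (b : {set 'I_n}) (i j k x y z : 'I_n).

(** What [mexp_split] leaves of [mexp H b i] once the terms containing [H i k] or [H k i] are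
    dropped. *)
Definition mexp_rest H b i k : K :=
  let c := b :\ i :\ k in mdet H (b :\ i) * H i i
   - \sum_(x in c) \sum_(y in c) H i x * cof H (b :\ i) x y * H y i.

Lemma mexp_rest_eq H H' b i k : i \in b ->
  (forall x y, ((x == i) && (y == k)) || ((x == k) && (y == i)) = false ->
     H x y = H' x y) ->
  i != k -> mexp_rest H b i k = mexp_rest H' b i k.
Proof.
move=> ib e ik; rewrite /mexp_rest; have [|-> ec] := @mdet_cof_eq _ _ H H' (b :\ i).
  move=> x y; rewrite !inE => /andP[xi _] /andP[yi _]; apply: e.
  by rewrite (negbTE xi) (negbTE yi) andbF.
congr (_ * _ - _).
  by apply: e; rewrite (negbTE ik) andbF.
apply: eq_bigr => x /setD1P[xk xbi]; apply: eq_bigr => y /setD1P[yk ybi].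
rewrite ec // !e //.
  by rewrite (negbTE yk) /= (negbTE ik) andbF.
by rewrite (negbTE xk) (negbTE ik) andbF.
Qed.

(** The dropped terms are symmetric in [i] and [k]: [H i k * H k i] is a norm, and the others form a
    sum [q + qconj q], which depends only on the real part of a product and hence not on the order
    of its factors. *)
Lemma mexp_diff H b i k :
  (forall H (c : {set 'I_n}), hermitian H -> c \proper b -> moore_good H c) ->
  hermitian H -> i \in b -> k \in b -> i != k ->
  mexp H b i - mexp H b k = mexp_rest H b i k - mexp_rest H b k i.
Proof.
move=> IH hH ib kb ik; have hE := (hermitianP H).1 hH.
have cen (c : {set 'I_n}) : c \proper b -> central (mdet H c).
  exact: (good_central IH hH).
rewrite (mexp_split ib kb) // (mexp_split kb ib) 1?eq_sym //.
rewrite /mexp_rest [b :\ k :\ i]setD1C; set c := b :\ i :\ k.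
set z := \sum_(x in c) \sum_(y in c) H k x * cof H c x y * H y i.
set w := \sum_(x in c) \sum_(y in c) H i x * cof H c x y * H y k.
have wE : w = qconj z.
  rewrite /w exchange_big qconj_sum; apply: eq_bigr => x xc.
  rewrite qconj_sum; apply: eq_bigr => y yc; rewrite !qconjM !hE mulrA.
  have cb : c \proper b by apply: (sub_proper_trans (subsetDl _ _)); apply: properD1.
  by have [_ -> //] := IH H c hH cb.
have e1 : H i k * H k i = H k i * H i k.
  by rewrite -(hE i k) qmul_conj qconj_mul.
have e2 : H i k * z + w * H k i = H k i * w + z * H i k.
  rewrite wE -(hE i k) -qconjM [RHS]addrC -qconjM !qadd_conj.
  by rewrite qreMC.
have subDD (u v t : K) : (u + t) - (v + t) = u - v.
  by rewrite opprD addrACA subrr addr0.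
by rewrite e1 e2 !subDD.
Qed.

(** The crux is [mexp_const]: expansions at any two indices of [b] agree, so each of them equals
    [mdet H b]. *)
Lemma moore_main b H : hermitian H -> moore_good H b.
Proof.
elim/set_proper_ind: b H => b IHb.
have IH H (c : {set 'I_n}) : hermitian H -> c \proper b -> moore_good H c.
  by move=> hH cb; apply: IHb.
move=> H hH.
have mexp_const i k : i \in b -> k \in b -> mexp H b i = mexp H b k.
  move=> ib kb; have [-> //|ik] := eqVneq i k.
  (* [mexp_comm] settles the case [H i k != 0]; by [mexp_diff] the difference of
     the two sides does not depend on [H i k], which may thus be taken to be 1. *)
  pose s x y := ((x == i) && (y == k)) || ((x == k) && (y == i)).
  pose H' : 'M[K]_n := \matrix_(x, y) if s x y then 1 else H x y.
  have hH' : hermitian H'.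
    apply/hermitianP => x y; rewrite !mxE.
    have -> : s y x = s x y by rewrite /s orbC andbC [X in _ || X]andbC.
    by case: ifP => _; [rewrite qconj1 | apply: (hermitianP H).1].
  have e x y : s x y = false -> H x y = H' x y by move=> sxy; rewrite mxE sxy.
  have e' x y : (x == k) && (y == i) || (x == i) && (y == k) = false ->
    H x y = H' x y by rewrite orbC; apply: e.
  have := mexp_comm IH hH' ib kb; rewrite mxE /s !eqxx mulr1 mul1r => c'.
  apply/eqP; rewrite -subr_eq0 mexp_diff //.
  rewrite (mexp_rest_eq ib e ik) (mexp_rest_eq kb e') 1?eq_sym //.
  by rewrite -mexp_diff // c' subrr.
have mdetE i : i \in b -> mdet H b = mexp H b i.
  move=> ib; rewrite /mdet /mdet_of; case: pickP => [j jb|/(_ i)].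
    exact: mexp_const.
  by rewrite ib.
split=> [i k ib kb|i y|].
- case: eqP => [<-|/eqP ik]; first by rewrite mul1r (mdetE i).
  by rewrite mul0r (cof_row_step IH).
- exact: (cof_herm_step IH).
have [->|[i ib]] := set_0Vmem b; first by rewrite mdet0 qconj1.
by rewrite (mdetE i) // (mexp_real IH).
Qed.
End MooreDeterminantTheory.

(** * Cofactor sums and the Moore-Penrose inverse *)

Section Adjoint.
Variable R : realType.
Local Notation K := (quat R).

Lemma adjqK m n (A : 'M[K]_(m, n)) : adjq (adjq A) = A.
Proof. by apply/matrixP => i j; rewrite !mxE qconjK. Qed.

Lemma adjqM m n p (A : 'M[K]_(m, n)) (B : 'M[K]_(n, p)) :
  adjq (A *m B) = adjq B *m adjq A.
Proof.
apply/matrixP => i j; rewrite !mxE qconj_sum.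
by apply: eq_bigr => k _; rewrite !mxE qconjM.
Qed.

Lemma adjqB m n (A B : 'M[K]_(m, n)) : adjq (A - B) = adjq A - adjq B.
Proof. by apply/matrixP => i j; rewrite !mxE raddfB. Qed.

Lemma adjq_scalar n (a : K) : adjq (a%:M : 'M_n) = (qconj a)%:M.
Proof. by apply/matrixP => i j; rewrite !mxE eq_sym raddfMn. Qed.

Lemma adjq0 m n : adjq (0 : 'M[K]_(m, n)) = 0.
Proof. by apply/matrixP => i j; rewrite !mxE raddf0. Qed.

Lemma adjqZ m n a (A : 'M[K]_(m, n)) : adjq (qreal a *: A) = qreal a *: adjq A.
Proof.
by apply/matrixP => i j; rewrite !mxE qconjM qconj_real qreal_comm.
Qed.

Lemma scaleqAr m n p a (A : 'M[K]_(m, n)) (B : 'M[K]_(n, p)) :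
  A *m (qreal a *: B) = qreal a *: (A *m B).
Proof.
apply/matrixP => i j; rewrite !mxE mulr_sumr.
by apply: eq_bigr => k _; rewrite !mxE !mulrA qreal_comm.
Qed.

Lemma adjq_gram m n (A : 'M[K]_(m, n)) : hermitian (adjq A *m A).
Proof. by rewrite /hermitian adjqM adjqK. Qed.

Lemma gram_diag m n (A : 'M[K]_(m, n)) i :
  (adjq A *m A) i i = qreal (\sum_k qnorm2 (A k i)).
Proof.
rewrite mxE raddf_sum; apply: eq_bigr => k _.
by rewrite mxE qconj_mul.
Qed.

Lemma gram_eq0 m n (A : 'M[K]_(m, n)) : adjq A *m A = 0 -> A = 0.
Proof.
move=> A0; apply/matrixP => i j; rewrite mxE.
have := gram_diag A j; rewrite A0 mxE -(raddf0 (@qreal R)) => /qreal_inj/esym/eqP.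
rewrite psumr_eq0 => [|k _]; last exact: qnorm2_ge0.
move=> /allP/(_ i); rewrite mem_index_enum => /(_ isT).
by rewrite qnorm2_eq0 => /eqP.
Qed.

(** For [Y = X H], the product of [Y] with its adjoint is [X H H] times the adjoint of [X], hence
    zero; positivity of norms then kills [Y]. *)
Lemma herm_cancel n p (X : 'M[K]_(p, n)) (H : 'M[K]_n) :
  hermitian H -> X *m H *m H = 0 -> X *m H = 0.
Proof.
move=> hH e; rewrite -[X *m H]adjqK (_ : adjq (X *m H) = 0) ?adjq0 //.
by apply: gram_eq0; rewrite adjqK adjqM hH mulmxA e mul0mx.
Qed.

Lemma gram_cancel m n p (A : 'M[K]_(m, n)) (Y : 'M[K]_(n, p)) :
  adjq A *m A *m Y = 0 -> A *m Y = 0.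
Proof.
move=> e; apply: gram_eq0.
by rewrite adjqM -mulmxA [_ *m (A *m _)]mulmxA e mulmx0.
Qed.
End Adjoint.

(** * The recursion for sums of cofactors *)

Section CofactorSums.
Variables (R : realType) (n : nat).
Local Notation K := (quat R).
Variable H : 'M[K]_n.
Hypothesis hH : hermitian H.
Implicit Types (b : {set 'I_n}).

Lemma cof_mul b i k : i \in b -> k \in b ->
  \sum_(y in b) cof H b i y * H y k = (i == k)%:R * mdet H b.
Proof. by move=> ib kb; have [-> //] := moore_main b hH. Qed.

Lemma cof_herm b i y : i \in b -> y \in b -> qconj (cof H b i y) = cof H b y i.
Proof. by move=> ib kb; have [_ -> //] := moore_main b hH. Qed.

Lemma mdet_conj b : qconj (mdet H b) = mdet H b.
Proof. by have [_ _] := moore_main b hH. Qed.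

Lemma mdet_central b : central (mdet H b).
Proof. exact/real_central/mdet_conj. Qed.

(** Over a commutative ring, [cof_sum k] and [mdet_sum k] would be the coefficients of [t^(n-k)] in
    the adjugate and the determinant of [t I + H]. *)
Definition cof_sum k : 'M[K]_n :=
  \matrix_(i, j) \sum_(b : {set 'I_n} | (#|b| == k) && (i \in b)) cof H b i j.

Definition mdet_sum k : K := \sum_(b : {set 'I_n} | #|b| == k) mdet H b.

Lemma mdet_sum_conj k : qconj (mdet_sum k) = mdet_sum k.
Proof. by rewrite qconj_sum; apply: eq_bigr => b _; rewrite mdet_conj. Qed.

Lemma cof_sum_herm k : hermitian (cof_sum k).
Proof.
apply/hermitianP => i j; rewrite !mxE qconj_sum big_mkcondr [RHS]big_mkcondr.
apply: eq_bigr => b _; case: ifP => ib; case: ifP => jb //.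
- by rewrite cof_herm.
- by rewrite cof_notin ?jb // raddf0.
- by rewrite cof_notin ?ib.
Qed.

Lemma cof_sum_big k : (n < k)%N -> cof_sum k = 0.
Proof.
move=> nk; apply/matrixP => i j; rewrite !mxE big1 // => b /andP[/eqP bk _].
by have := max_card (mem b); rewrite bk card_ord leqNgt nk.
Qed.

Lemma sum_setU1 (P : pred {set 'I_n}) (F : {set 'I_n} -> K) k j :
  (forall b, P (j |: b) = P b) ->
  \sum_(b : {set 'I_n} | (#|b| == k.+1) && (j \in b) && P b) F b =
  \sum_(b : {set 'I_n} | (#|b| == k) && (j \notin b) && P b) F (j |: b).
Proof.
move=> PU; rewrite (reindex_onto (fun b => j |: b) (fun b => b :\ j)) /=.
  apply: eq_bigl => b; rewrite setU11 andbT PU.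
  case: (boolP (j \in b)) => jb; last by rewrite setU1K // eqxx cardsU1 jb !andbT.
  rewrite andbF; apply/negbTE; rewrite !negb_and; apply/orP; right.
  by apply/eqP => e; move: jb; rewrite -e !inE eqxx.
by move=> b /andP[/andP[_ jb] _]; rewrite setD1K.
Qed.

(** On the diagonal, the sets containing [i] come from the first term and the others from the
    second, through [i |: b]. Off the diagonal, a set containing both [i] and [j] contributes zero
    by [cof_mul], and a set [b] without [j] cancels against [j |: b] by [cof_col]. *)
Lemma cof_sum_rec k : cof_sum k *m H + cof_sum k.+1 = (mdet_sum k)%:M.
Proof.
apply/matrixP => i j; rewrite !mxE.
have -> : \sum_l cof_sum k i l * H l j =
   \sum_(b : {set 'I_n} | (#|b| == k) && (i \in b))
      \sum_(l in b) cof H b i l * H l j.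
  under eq_bigr => l _ do rewrite mxE mulr_suml.
  rewrite exchange_big; apply: eq_bigr => b /andP[_ ib] /=.
  rewrite [RHS]big_mkcond; apply: eq_bigr => l _; case: ifPn => // lb.
  by rewrite cof_notin // mul0r.
have [<-|ij] := eqVneq i j.
  rewrite mulr1n /mdet_sum [RHS](bigID (fun b : {set 'I_n} => i \in b)) /=.
  congr (_ + _).
    by apply: eq_bigr => b /andP[_ ib]; rewrite cof_mul // eqxx mul1r.
  transitivity (\sum_(b : {set 'I_n} | (#|b| == k.+1) && (i \in b) && true)
      cof H b i i); first by apply: eq_bigl => b; rewrite andbT.
  rewrite (@sum_setU1 predT) //; apply: eq_big => b; first by rewrite andbT.
  by move=> /andP[/andP[_ ib] _]; rewrite cof_diag ?setU11 ?setU1K.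
rewrite mulr0n (bigID (fun b : {set 'I_n} => j \in b)) /= big1 ?add0r; last first.
  by move=> b /andP[/andP[_ ib] jb]; rewrite cof_mul // (negbTE ij) mul0r.
rewrite [X in _ + X](bigID (fun b : {set 'I_n} => j \in b)) /= addrC.
rewrite [X in _ + X + _]big1 ?addr0 => [|b /andP[/andP[_ ib] jb]]; last first.
  exact: cof_notin.
under eq_bigl do rewrite andbAC.
rewrite (@sum_setU1 (fun b => i \in b)) => [|b]; last first.
  by rewrite !inE (negbTE ij).
under eq_bigl do rewrite andbAC.
rewrite -big_split big1 //= => b /andP[/andP[_ jb] ib].
rewrite cof_col ?setU11 //; last by rewrite !inE ib orbT.
  by rewrite setU1K // addNr.
by move=> c _; apply: mdet_central.
Qed.

Variable r : nat.
Hypothesis mdet_sum_gt : forall k, (r < k)%N -> mdet_sum k = 0.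

(** Downward induction from [k > n], where [cof_sum k] is an empty sum. As [mdet_sum k] vanishes,
    [cof_sum k.+1] is [- cof_sum k *m H], and [herm_cancel] removes the surplus factor [H]. *)
Lemma cof_sum_gt k : (r < k)%N -> cof_sum k *m H = 0.
Proof.
move: {2}(n.+1 - k)%N (leqnn (n.+1 - k)) => d; elim: d k => [|d IHd] k nk rk.
  by rewrite cof_sum_big ?mul0mx // -subn_eq0 -leqn0.
have kd : (n.+1 - k.+1 <= d)%N by rewrite subnS; case: (n.+1 - k)%N nk.
have := IHd _ kd (ltnW rk); have := cof_sum_rec k.
rewrite mdet_sum_gt // raddf0 => /eqP; rewrite addrC addr_eq0 => /eqP->.
rewrite mulNmx => /eqP; rewrite oppr_eq0 => /eqP; exact: herm_cancel.
Qed.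

Variable d : R.
Hypothesis mdet_sum_r : mdet_sum r = qreal d.

Lemma cof_sum_comm k : cof_sum k *m H = H *m cof_sum k.
Proof.
have : cof_sum k *m H = (mdet_sum k)%:M - cof_sum k.+1.
  by rewrite -cof_sum_rec addrK.
move=> e; have := congr1 (@adjq R n n) e.
by rewrite adjqM hH adjqB adjq_scalar mdet_sum_conj !cof_sum_herm => ->.
Qed.

Lemma cof_sum_HH : cof_sum r *m H *m H = qreal d *: H.
Proof.
have -> : cof_sum r *m H = (mdet_sum r)%:M - cof_sum r.+1.
  by rewrite -cof_sum_rec addrK.
by rewrite mulmxBl cof_sum_gt // subr0 mul_scalar_mx mdet_sum_r.
Qed.
End CofactorSums.

(** * The Moore-Penrose inverse from cofactor sums *)

Section MoorePenrose.
Variables (R : realType) (m n r : nat) (A : 'M[quat R]_(m, n)) (d : R).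
Let H := adjq A *m A.
Hypothesis mdet_sum_gt : forall k, (r < k)%N -> mdet_sum H k = 0.
Hypothesis mdet_sum_r : mdet_sum H r = qreal d.

Let hH : hermitian H := adjq_gram A.
Let HH := cof_sum_HH hH mdet_sum_gt mdet_sum_r.

(** The adjoint of [A] is [H X], and [X] itself has the form [H X W]; so a factor [H H] appears next
    to [cof_sum H r], and [cof_sum_HH] applies. *)
Lemma mpinv_cof_sum X : is_mpinv A X -> cof_sum H r *m adjq A = qreal d *: X.
Proof.
case=> AXA XAX AXh XAh.
have Ast : adjq A = H *m X by rewrite -{1}AXA adjqM AXh mulmxA.
have [W Xe] : exists W, X = H *m X *m W.
  by exists (adjq X *m X); rewrite -Ast mulmxA -adjqM XAh XAX.
rewrite Ast [in LHS]Xe [H *m (_ *m _)]mulmxA [H *m (_ *m _)]mulmxA.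
by rewrite 3!mulmxA HH -!scalemxAl -Xe.
Qed.

(** The witness is the matrix imposed by [mpinv_cof_sum]: [G] commutes with [H] and inverts it on
    its range. *)
Lemma mpinv_ex : d != 0 -> exists X, is_mpinv A X.
Proof.
move=> d0; pose G := qreal d^-1 *: cof_sum H r.
have Gh : adjq G = G by rewrite adjqZ cof_sum_herm.
have GHH : G *m H *m H = H.
  by rewrite -!scalemxAl HH scalerA -qrealM mulVf // scale1r.
have GC : G *m H = H *m G by rewrite scaleqAr -scalemxAl cof_sum_comm.
have AGH : A *m (G *m H) = A.
  apply/eqP; rewrite -subr_eq0 -{2}[A]mulmx1 -mulmxBr; apply/eqP.
  apply: gram_cancel; rewrite -/H mulmxBr mulmx1 mulmxA -GC GHH.
  by rewrite subrr.
have AGAA : A *m G *m adjq A *m A = A by rewrite -!mulmxA -/H.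
exists (G *m adjq A); split.
- by rewrite mulmxA.
- have := congr1 (@adjq R m n) AGAA; rewrite !adjqM adjqK Gh => e.
  by rewrite -!mulmxA; congr (G *m _).
- by rewrite !adjqM adjqK Gh mulmxA.
- by rewrite -mulmxA -/H adjqM Gh hH -GC.
Qed.
End MoorePenrose.

(** * Rank *)

Section Rank.
Variable R : realType.
Local Notation K := (quat R).

(** Coefficient vectors keep their full length and are supported on [b], which avoids reindexing;
    [indep_colsP] relates this form to [indep_cols]. *)
Definition indep m n (A : 'M[K]_(m, n)) (b : {set 'I_n}) : Prop :=
  forall c : 'cV[K]_n, (forall i, i \notin b -> c i 0 = 0) -> A *m c = 0 -> c = 0.

Lemma indepS m n (A : 'M[K]_(m, n)) (b c : {set 'I_n}) :
  b \subset c -> indep A c -> indep A b.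
Proof.
move=> /subsetP bc ic v vb; apply: ic => i ic; apply: vb.
by apply: contra ic; apply: bc.
Qed.

Lemma not_indep m n (A : 'M[K]_(m, n)) b : ~ indep A b ->
  exists c : 'cV[K]_n,
    [/\ forall i, i \notin b -> c i 0 = 0, A *m c = 0 & c != 0].
Proof.
move=> /existsNP[c /not_implyP[cb /not_implyP[Ac c0]]]; exists c; split=> //.
exact/eqP.
Qed.

Lemma cV_neq0 n (c : 'cV[K]_n) : c != 0 -> exists i, c i 0 != 0.
Proof.
move=> c0; apply/existsP; apply: contraR c0; rewrite negb_exists => /forallP h.
by apply/eqP/matrixP => i j; rewrite ord1 mxE; apply/eqP; move: (h i); rewrite negbK.
Qed.

Section Gram.
Variables (m n : nat) (A : 'M[K]_(m, n)).
Let H := adjq A *m A.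
Let hH : hermitian H := adjq_gram A.

(** For a relation [c] among the columns, applying the cofactor matrix to [H c = 0] gives
    [mdet H b * c i 0 = 0] at an index where [c] is nonzero. *)
Lemma mdet_dep b : ~ indep A b -> mdet H b = 0.
Proof.
move=> /not_indep[c [cb Ac /cV_neq0[i ci]]].
have ib : i \in b by apply: contraR ci => /cb->.
have Hc y : \sum_(k in b) H y k * c k 0 = 0.
  transitivity ((H *m c) y 0); last by rewrite -mulmxA Ac mulmx0 mxE.
  rewrite mxE [RHS](bigID (mem b)) /= [X in _ + X]big1 ?addr0 // => k kb.
  by rewrite cb ?mulr0.
apply: (@qmul_eq0r _ _ (c i 0)) => //.
transitivity (\sum_(k in b) (\sum_(y in b) cof H b i y * H y k) * c k 0).
  rewrite (bigD1 i) //= cof_mul // eqxx mul1r big1 ?addr0 // => k /andP[kb ki].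
  by rewrite cof_mul // eq_sym (negbTE ki) !mul0r.
under eq_bigr => k _ do rewrite mulr_suml.
rewrite exchange_big big1 // => y yb.
by under eq_bigr => k _ do rewrite -mulrA; rewrite -mulr_sumr Hc mulr0.
Qed.

Lemma mdet_indep b : indep A b -> exists2 a : R, 0 < a & mdet H b = qreal a.
Proof.
elim/setD1_ind: b => b IH ib; have [->|[i bi]] := set_0Vmem b.
  by exists 1; rewrite ?ltr01 // mdet0.
have [a a0 ea] := IH i bi (indepS (subsetDl _ _) ib).
have /qconj_fixed et := mdet_conj hH b; exists (qre (mdet H b)) => //.
(* [v^* H v = mdet H b * mdet H (b :\ i)] is positive. *)
pose v : 'cV[K]_n := \col_y (if y \in b then qconj (cof H b i y) else 0).
(* The entry of [v] at [i] is the positive number [mdet H (b :\ i)], so independence of [b]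
   applies. *)
have Av : A *m v != 0.
  apply/eqP => /ib v0; have : v i 0 = 0.
    by rewrite v0 ?mxE // => y /negbTE yb; rewrite mxE yb.
  rewrite mxE bi cof_diag // ea qconj_real -[RHS](raddf0 (@qreal R)).
  by move/qreal_inj => a1; rewrite a1 ltxx in a0.
have Avv := gram_diag (A *m v) 0.
have e : (adjq (A *m v) *m (A *m v)) 0 0 = mdet H b * qreal a.
  rewrite adjqM -!mulmxA [adjq A *m _]mulmxA -/H mulmxA mxE.
  transitivity (\sum_(z in b) ((i == z)%:R * mdet H b) * qconj (cof H b i z)).
    rewrite [LHS](bigID (mem b)) /= [X in _ + X]big1 ?addr0; last first.
      by move=> z /negbTE zb; rewrite [v z 0]mxE zb mulr0.
    apply: eq_bigr => z zb; rewrite [v z 0]mxE zb; congr (_ * _).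
    rewrite mxE -(cof_mul hH) // [LHS](bigID (mem b)) /=.
    rewrite [X in _ + X]big1 ?addr0; last first.
      by move=> y /negbTE yb; rewrite !mxE yb raddf0 mul0r.
    by apply: eq_bigr => y yb; rewrite 2!mxE yb qconjK.
  rewrite (bigD1 i) //= eqxx mul1r big1 ?addr0; last first.
    by move=> z /andP[_ zi]; rewrite eq_sym (negbTE zi) !mul0r.
  by rewrite cof_diag // ea qconj_real.
have : 0 < \sum_k qnorm2 ((A *m v) k 0).
  have [k k0] := cV_neq0 Av; rewrite (bigD1 k) //= ltr_wpDr //.
    by rewrite sumr_ge0 // => ? _; apply: qnorm2_ge0.
  by rewrite lt_def qnorm2_eq0 k0 qnorm2_ge0.
have /qreal_inj-> : qreal (\sum_k qnorm2 ((A *m v) k 0)) =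
   qreal (qre (mdet H b) * a) by rewrite -Avv e qrealM -et.
by rewrite pmulr_lgt0.
Qed.
End Gram.

Lemma indep_colsP m n (A : 'M[K]_(m, n)) k :
  indep_cols A k <-> exists2 b : {set 'I_n}, #|b| = k & indep A b.
Proof.
split=> [[f fA]|[b <- bA]].
  (* Two equal values of [f] would put a difference of unit vectors in the kernel. *)
  have finj : injective f.
    move=> x y fxy; apply/eqP/negPn/negP => xy.
    have e0 : colsub f A *m (delta_mx x 0 - delta_mx y 0) = 0 :> 'cV_m.
      rewrite mulmxBr -!colE; apply/matrixP => i j.
      by rewrite !mxE fxy subrr.
    have /matrixP/(_ x 0) := fA _ e0.
    by rewrite !mxE !eqxx (negbTE xy) subr0 => /eqP; rewrite oner_eq0.
  exists (f @: 'I_k); first by rewrite card_imset // card_ord.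
  move=> c cb Ac; have c0 : rowsub f c = 0.
    apply: fA; rewrite -[RHS]Ac; apply/matrixP => i j; rewrite !mxE.
    rewrite [RHS](bigID (mem (f @: 'I_k))) /= [X in _ + X]big1 ?addr0; last first.
      by move=> z zb; rewrite ord1 cb ?mulr0.
    rewrite big_imset /=; last by move=> ? ? _ _ /finj.
    by apply: eq_big => [x|x _]; rewrite ?inE // !mxE.
  apply/matrixP => i j; rewrite ord1 mxE.
  have [/imsetP[x _ ->]|/cb //] := boolP (i \in f @: 'I_k).
  by have /matrixP/(_ x 0) := c0; rewrite !mxE.
exists enum_val => c cA.
pose c' : 'cV[K]_n := \col_i
  (if [pick x | enum_val x == i] is Some x then c x 0 else 0).
have c'E x : c' (enum_val x) 0 = c x 0.
  rewrite mxE; case: pickP => [y /eqP/enum_val_inj-> //|/(_ x)].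
  by rewrite eqxx.
have c'0 i : i \notin b -> c' i 0 = 0.
  by rewrite mxE; case: pickP => // x /eqP<-; rewrite enum_valP.
suff /matrixP e : c' = 0 by apply/matrixP => x j; rewrite ord1 -c'E e !mxE.
apply: bA => //; apply/matrixP => i j; rewrite -cA ord1 !mxE.
rewrite (bigID (mem b)) /= [X in _ + X]big1 ?addr0 => [|z zb]; last first.
  by rewrite c'0 ?mulr0.
by rewrite big_enum_val; apply: eq_bigr => x _; rewrite c'E !mxE.
Qed.

Lemma indep_card m n (A : 'M[K]_(m, n)) b : indep A b -> (#|b| <= qrank A)%N.
Proof.
move=> bA; have hb : (#|b| < n.+1)%N.
  by rewrite ltnS -[X in (_ <= X)%N]card_ord max_card.
have P : `[< indep_cols A (Ordinal hb) >] by apply/asboolP/indep_colsP; exists b.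
by rewrite /qrank (bigD1 (Ordinal hb)) //= leq_max leqnn.
Qed.

Lemma indep_rank m n (A : 'M[K]_(m, n)) :
  exists2 b : {set 'I_n}, #|b| = qrank A & indep A b.
Proof.
apply/indep_colsP; rewrite /qrank.
have P0 : `[< indep_cols A (ord0 : 'I_n.+1) >].
  by apply/asboolP/indep_colsP; exists set0; rewrite ?cards0 // => c c0 _;
     apply/matrixP => i j; rewrite ord1 mxE c0 // inE.
have [|k kP ->] := @eq_bigmax_cond _ (fun k : 'I_n.+1 => `[< indep_cols A k >])
  (fun k => k : nat); last by apply/asboolP.
by apply/card_gt0P; exists ord0.
Qed.

Section GramSums.
Variables (m n : nat) (A : 'M[K]_(m, n)).
Let H := adjq A *m A.

Lemma mdet_sum_gt_rank k : (qrank A < k)%N -> mdet_sum H k = 0.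
Proof.
move=> rk; rewrite /mdet_sum big1 // => b /eqP bk; apply: mdet_dep => /indep_card.
by rewrite bk leqNgt rk.
Qed.

(** All summands are nonnegative reals, and an independent set of maximal size contributes a
    positive one. *)
Lemma mdet_sum_rank : exists2 d : R, 0 < d & mdet_sum H (qrank A) = qreal d.
Proof.
have h b : 0 <= qre (mdet H b) /\ mdet H b = qreal (qre (mdet H b)).
  have [/mdet_indep[a a0 e]|/mdet_dep e] := pselect (indep A b).
    by rewrite e /= (ltW a0).
  by rewrite e /=.
have [b bk /mdet_indep[a a0 e]] := indep_rank A.
exists (\sum_(b : {set 'I_n} | #|b| == qrank A) qre (mdet H b)).
  rewrite (bigD1 b) ?bk //= e /= ltr_wpDr // sumr_ge0 // => c _.
  by have [] := h c.
by rewrite raddf_sum; apply: eq_bigr => c _; have [] := h c.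
Qed.
End GramSums.

Lemma mpinvP m n (A : 'M[K]_(m, n)) : is_mpinv A (mpinv A).
Proof.
apply: epsilon_spec; have [d d0 e] := mdet_sum_rank A.
by apply: (mpinv_ex (@mdet_sum_gt_rank _ _ A) e); rewrite gt_eqF.
Qed.

(** Gaussian elimination by induction on the number of rows; a zero first row is simply
    discarded. *)
Lemma wide_kernel k l (M : 'M[K]_(k, l)) : (k < l)%N ->
  exists2 c : 'cV[K]_l, c != 0 & M *m c = 0.
Proof.
elim: k l M => [|k IH] [//|l] M kl.
  exists (const_mx 1); last by apply/matrixP => -[].
  by apply/eqP => /matrixP/(_ 0 0)/eqP; rewrite !mxE oner_eq0.
have [/existsP[j Mj]|] := boolP [exists j, M 0 j != 0]; last first.
  rewrite negb_exists => /forallP M0.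
  have [c c0 Mc] := IH l.+1 (\matrix_(i, j) M (lift 0 i) j) (ltnW kl).
  exists c => //; apply/matrixP => i j; rewrite mxE.
  have [i' ->|->] := unliftP 0 i.
    have /matrixP/(_ i' j) := Mc; rewrite !mxE => e; rewrite -[RHS]e.
    by apply: eq_bigr => z _; rewrite mxE.
  rewrite mxE big1 // => z _; have := M0 z; rewrite negbK => /eqP->.
  by rewrite mul0r.
(* Elimination with pivot [M 0 j]; below, [t] solves the first equation for the unknown at [j]. *)
pose M' := \matrix_(i, z) (M (lift 0 i) (lift j z)
   - M (lift 0 i) j * qinv (M 0 j) * M 0 (lift j z)) : 'M[K]_(k, l).
have [c' c'0 Mc'] := IH l M' kl.
pose t := - (qinv (M 0 j) * \sum_z M 0 (lift j z) * c' z 0).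
pose c : 'cV[K]_l.+1 := \col_z (if unlift j z is Some z' then c' z' 0 else t).
have cj : c j 0 = t by rewrite mxE unlift_none.
have cl z : c (lift j z) 0 = c' z 0 by rewrite mxE liftK.
have Mce i : (M *m c) i 0 = M i j * t + \sum_z M i (lift j z) * c' z 0.
  rewrite mxE (bigD1_ord j) //= cj; congr (_ + _).
  by apply: eq_bigr => z _; rewrite cl.
exists c.
  have [z cz] := cV_neq0 c'0; apply: contraNneq cz => c0.
  by rewrite -cl c0 mxE.
apply/matrixP => i o; rewrite [o]ord1 [RHS]mxE Mce.
have [i' ->|->] := unliftP 0 i; last by rewrite mulrN mulrA qmulV // mul1r addNr.
have /matrixP/(_ i' 0) := Mc'; rewrite !mxE => e; rewrite -[RHS]e.
under [RHS]eq_bigr => z _ do rewrite mxE mulrBl -!mulrA.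
by rewrite sumrB -!mulr_sumr addrC mulrN.
Qed.

(** If a maximal independent set [b] of rows were smaller than the column rank, [wide_kernel] would
    give a combination [w] of independent columns vanishing on [b], hence on every row. *)
Lemma qrank_adj_le m n (A : 'M[K]_(m, n)) : (qrank A <= qrank (adjq A))%N.
Proof.
have [b bk bA] := indep_rank (adjq A).
have [f fA] : indep_cols A (qrank A) by apply/indep_colsP/indep_rank.
rewrite leqNgt; apply/negP; rewrite -bk => br.
have [c c0 Mc] := wide_kernel (\matrix_(x, y) A (enum_val x) (f y)) br.
case/eqP: c0; apply: fA; set w := _ *m _.
have wb j : j \in b -> w j 0 = 0.
  move=> jb; have /matrixP/(_ (enum_rank_in jb j) 0) := Mc.
  rewrite !mxE => e; rewrite -[RHS]e; apply: eq_bigr => y _.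
  by rewrite !mxE enum_rankK_in.
apply/matrixP => j o; rewrite ord1 [RHS]mxE {o}.
have [/wb //|jb] := boolP (j \in b).
(* Maximality of [b] yields a relation [d] between row [j] and the rows in [b]. Its entry at [j] is
   nonzero, and pairing it with [w] leaves only the term at [j]. *)
have /not_indep[d [db Ad d0]] : ~ indep (adjq A) (j |: b).
  by move=> /indep_card; rewrite cardsU1 jb bk ltnn.
have dj : d j 0 != 0.
  apply: contraNneq d0 => dj0; apply/eqP; apply: bA => // i ib.
  by have [->//|ij] := eqVneq i j; apply: db; rewrite !inE negb_or ij.
have dA : adjq d *m A = 0 by rewrite -[A]adjqK -adjqM Ad adjq0.
have : (adjq d *m w) 0 0 = 0.
  have -> : adjq d *m w = colsub f (adjq d *m A) *m c.
    rewrite /w mulmxA; congr (_ *m c); apply/matrixP => x y; rewrite !mxE.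
    by apply: eq_bigr => z _; rewrite !mxE.
  by rewrite dA mxE big1 // => z _; rewrite !mxE mul0r.
rewrite mxE (bigD1 j) //= big1 ?addr0 => [|i ij].
  rewrite mxE => /qmul_eq0; apply.
  by rewrite -(raddf0 (@qconj R)) (can_eq (@qconjK R)).
have [ib|ib] := boolP (i \in b); first by rewrite wb ?mulr0.
by rewrite mxE db ?raddf0 ?mul0r // !inE negb_or ij.
Qed.

Lemma qrank_adj m n (A : 'M[K]_(m, n)) : qrank (adjq A) = qrank A.
Proof.
by apply/eqP; rewrite eqn_leq qrank_adj_le andbT -{2}[A]adjqK qrank_adj_le.
Qed.
End Rank.

(** * Column and row determinants *)

Section CycleSurgery.

(** [fingraph.orbit] lists a cycle in order from its starting point, whereas [porbit] is only a set;
    the cycle surgery needs the list. *)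
Lemma mem_porbit_orbit n (s : 'S_n) x y :
  (y \in porbit s x) = (y \in fingraph.orbit s x).
Proof.
rewrite -fconnect_orbit; apply/porbitP/idP => [[m ->]|/iter_findex <-].
  by rewrite permX fconnect_iter.
by eexists; rewrite permX.
Qed.

Lemma card_porbit_order n (s : 'S_n) x : #|porbit s x| = fingraph.order s x.
Proof.
rewrite -size_orbit -(card_uniqP (orbit_uniq s x)).
exact/eq_card/mem_porbit_orbit.
Qed.

Lemma cyc_min_orbit n (s : 'S_n) (x : 'I_n) :
  cyc_min s x = all (fun y : 'I_n => (x <= y)%N) (fingraph.orbit s x).
Proof.
apply/forall_inP/allP => h y.
  by rewrite -mem_porbit_orbit; apply: h.
by rewrite mem_porbit_orbit; apply: h.
Qed.

Lemma orbit_head (T : finType) (f : T -> T) x p :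
  fcycle f (x :: p) -> uniq (x :: p) -> fingraph.orbit f x = x :: p.
Proof.
move=> fc u; rewrite (fingraph.orbitE fc u) ?mem_head //= eqxx; exact: rot0.
Qed.

Lemma orbit_cons (T : finType) (f : T -> T) x :
  fingraph.orbit f x = x :: behead (fingraph.orbit f x).
Proof. by rewrite /fingraph.orbit -orderSpred. Qed.

Section Splice.
Variables (k : nat) (i : 'I_k.+1) (t : 'S_k).

(* [i] is inserted just before [x] in its cycle of [t], or made a fixed point
   if [x = i]; every permutation of ['I_k.+1] arises once in this way. *)
Definition splice (x : 'I_k.+1) : 'S_k.+1 := (lift_perm i i t * tperm i x)%g.

Lemma splice_head x : splice x i = x.
Proof. by rewrite permM lift_perm_id tpermL. Qed.

Lemma splice_lift x y : lift i (t y) != x -> splice x (lift i y) = lift i (t y).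
Proof.
by move=> h; rewrite permM lift_perm_lift tpermD ?neq_lift 1?eq_sym.
Qed.

Lemma splice_last x y : lift i (t y) = x -> splice x (lift i y) = i.
Proof. by move=> h; rewrite permM lift_perm_lift h tpermR. Qed.

Lemma sign_splice x : odd_perm (splice x) = (x != i) (+) odd_perm t.
Proof. by rewrite odd_permM odd_lift_perm addbb addFb odd_tperm addbC eq_sym. Qed.

Lemma splice_path x z p : x \notin map (lift i) p -> fpath t z p ->
  fpath (splice x) (lift i z) (map (lift i) p).
Proof.
elim: p z => //= y p IH z; rewrite inE negb_or => /andP[xy xp].
case/andP=> /eqP tz tp; rewrite IH // andbT; apply/eqP.
by rewrite splice_lift tz // eq_sym.
Qed.

Lemma splice_orbit x y : x \notin map (lift i) (fingraph.orbit t y) ->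
  fingraph.orbit (splice x) (lift i y) = map (lift i) (fingraph.orbit t y).
Proof.
move=> xy; have := cycle_orbit (perm_inj (s := t)) y.
have := orbit_uniq t y; move: xy; rewrite orbit_cons; set p := behead _.
rewrite -(map_inj_uniq (@lift_inj _ i)) /= => xp u tp.
apply: orbit_head => //; rewrite /= -map_rcons; apply: splice_path => //.
by rewrite map_rcons mem_rcons.
Qed.

Lemma splice_orbit_head x :
  fingraph.orbit (splice (lift i x)) i = i :: map (lift i) (fingraph.orbit t x).
Proof.
have := cycle_orbit (perm_inj (s := t)) x; have := orbit_uniq t x.
rewrite [fingraph.orbit t x]orbit_cons; set p := behead _ => u.
rewrite (cycle_path x) /=.
have xp : x \notin p by move: u; case/andP.
case/andP=> /eqP lx tp; apply: orbit_head; last first.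
  change (uniq (i :: map (lift i) (x :: p))).
  rewrite cons_uniq map_inj_uniq ?u ?andbT; last exact: lift_inj.
  by apply/negP => /mapP[z _ /eqP]; rewrite (negbTE (neq_lift _ _)).
rewrite /= splice_head eqxx /= rcons_path splice_path //; last first.
  by rewrite mem_map //; apply: lift_inj.
by rewrite last_map /= splice_last // lx.
Qed.

Lemma splice_orbit_fix : fingraph.orbit (splice i) i = [:: i].
Proof. by apply: orbit_head => //=; rewrite splice_head eqxx. Qed.

Lemma splice_orbit_id y :
  fingraph.orbit (splice i) (lift i y) = map (lift i) (fingraph.orbit t y).
Proof.
apply: splice_orbit; apply/negP => /mapP[z _ /eqP].
by rewrite (negbTE (neq_lift _ _)).
Qed.

End Splice.
End CycleSurgery.

(** Both sides have [(k+1)!] elements, so injectivity suffices; [x] is recovered as the image of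
    [i]. *)
Lemma splice_bij k (i : 'I_k.+1) :
  bijective (fun p : 'I_k.+1 * 'S_k => splice i p.2 p.1).
Proof.
apply: inj_card_bij => [[x t] [x' t'] /= e|]; last first.
  by rewrite card_prod card_ord !card_Sn factS.
have ex : x = x' by rewrite -(splice_head i t x) e splice_head.
rewrite ex in e *; congr pair; have {}e := mulIg _ _ _ e.
apply/permP => y; apply: (@lift_inj _ i).
by rewrite -!(lift_perm_lift i i) e.
Qed.

(** Two strictly increasing lists with the same members coincide. Thus deleting [i] preserves the
    order in which cycles are multiplied. *)
Lemma filter_enum_lift k (i : 'I_k.+1) :
  [seq x <- enum 'I_k.+1 | x != i] = [seq lift i y | y <- enum 'I_k].
Proof.
have lt_enum m : sorted (fun x y : 'I_m => (x < y)%N) (enum 'I_m).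
  have := iota_ltn_sorted 0 m; rewrite -val_enum_ord sorted_map.
  exact.
apply: (@irr_sorted_eq _ (fun x y : 'I_k.+1 => (x < y)%N)).
- by move=> x y z; apply: ltn_trans.
- by move=> x; rewrite ltnn.
- by apply: sorted_filter (lt_enum _) => x y z; apply: ltn_trans.
- rewrite sorted_map; apply: sub_sorted (lt_enum k) => x y xy /=.
  by rewrite ltnNge leq_bump2 -ltnNge.
move=> x; rewrite mem_filter mem_enum andbT.
have [y ->|->] := unliftP i x.
  by rewrite eq_sym neq_lift mem_map ?mem_enum //; apply: lift_inj.
rewrite eqxx; apply/esym/negP => /mapP[z _ /eqP].
by rewrite (negbTE (neq_lift _ _)).
Qed.

(** * Column determinants satisfy the cofactor recursion *)

Section DeterminantRecursion.
Variable R : realType.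
Local Notation K := (quat R).

(** The final weight [b] stands for a replaced column; the choice [F^~ x] closes the walk into a
    cycle. *)
Fixpoint walk n (F : 'M[K]_n) (b : 'I_n -> K) (x : 'I_n) (p : seq 'I_n) : K :=
  if p is y :: p' then F x y * walk F b y p' else b x.

Definition cycle_tail n (s : 'S_n) (x : 'I_n) := behead (fingraph.orbit s x).

Lemma walk_eq n (F G : 'M[K]_n) b c x p :
  (forall u v, v \in p -> F u v = G u v) -> {in x :: p, b =1 c} ->
  walk F b x p = walk G c x p.
Proof.
elim: p x => [|y p IH] x FG bc /=; first by apply: bc; rewrite mem_head.
rewrite FG ?mem_head //; congr (_ * _); apply: IH => [u v vp|u up].
  by apply: FG; rewrite inE vp orbT.
by apply: bc; rewrite inE up orbT.
Qed.

Lemma walk_traject n (F : 'M[K]_n) b (f : 'I_n -> 'I_n) x d :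
  walk F b x (traject f (f x) d) =
  (\prod_(l < d) F (iter l f x) (iter l.+1 f x)) * b (iter d f x).
Proof.
elim: d x => [|d IH] x /=; first by rewrite big_ord0 mul1r.
rewrite IH big_ord_recl -mulrA /=; congr (_ * (_ * b _)); last by rewrite -iterSr.
by apply: eq_bigr => l _; rewrite -!iterSr.
Qed.

Lemma cyc_prod_walk n (F : 'M[K]_n) (s : 'S_n) x :
  cyc_prod F s x = walk F (F^~ x) x (cycle_tail s x).
Proof.
rewrite /cyc_prod card_porbit_order /cycle_tail /fingraph.orbit.
rewrite -orderSpred /= walk_traject big_ord_recr /=.
congr (_ * _); first by apply: eq_bigr => l _; rewrite !permX.
by rewrite !permX orderSpred iter_order //; apply: perm_inj.
Qed.

(* [w] accumulates the initial part of the cycle of [i] removed by [walk_det_rec];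
   the product over the other cycles stands on its left. *)
Definition walk_det n (F : 'M[K]_n) (i : 'I_n) (w : K) (b : 'I_n -> K) : K :=
  \sum_(s : 'S_n) (-1) ^+ s *
    (\prod_(x <- rev (enum 'I_n) | cyc_min s x && (i \notin porbit s x))
        cyc_prod F s x * w * walk F b i (cycle_tail s i)).

(** Moore's expansion: every cycle starts at its least element and no index is distinguished. *)
Definition cycle_det n (F : 'M[K]_n) : K :=
  \sum_(s : 'S_n) (-1) ^+ s *
    \prod_(x <- rev (enum 'I_n) | cyc_min s x) cyc_prod F s x.

Lemma sign_porbits n (s : 'S_n) : (-1) ^+ (n - #|porbits s|) = (-1) ^+ s :> K.
Proof.
rewrite -signr_odd oddB ?/odd_perm ?card_ord //.
by rewrite -[X in (_ <= X)%N]card_ord leq_imset_card.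
Qed.

(** Column [j] is entered only by the last edge of the cycle through [j], so its replacement affects
    just the final weight of that walk. *)
Lemma cdet_colrep n (F : 'M[K]_n) j (b : 'cV[K]_n) :
  cdet j (colrep F j b) = walk_det F j 1 (b^~ 0).
Proof.
apply: eq_bigr => s _; rewrite sign_porbits mulr1; congr (_ * (_ * _)).
  apply: eq_bigr => x /andP[_]; rewrite mem_porbit_orbit => jx.
  have nj v : v \in fingraph.orbit s x -> (v == j) = false.
    by move=> vx; apply/negbTE; apply: contraNneq jx => <-.
  rewrite !cyc_prod_walk; apply: walk_eq => [u v vp|v vp].
    by rewrite mxE nj // orbit_cons inE vp orbT.
  by rewrite mxE nj // in_orbit.
have := orbit_uniq s j; rewrite orbit_cons => /andP[jp _].
rewrite cyc_prod_walk; apply: walk_eq => [u v vp|v vp]; rewrite mxE ?eqxx //.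
by case: eqP vp => // ->; rewrite /cycle_tail (negbTE jp).
Qed.

Lemma cycle_det0 (F : 'M[K]_0) : cycle_det F = 1.
Proof.
rewrite /cycle_det (bigD1 1%g) //= [X in _ + X]big1 ?addr0; last first.
  by move=> s /eqP[]; apply/permP => -[].
by rewrite odd_perm1 mul1r enum_ord0 big_nil.
Qed.

(* The cycle of [0] has the least minimum, so [cycle_det] puts it last as well. *)
Lemma cdet_cycle_det n (F : 'M[K]_n.+1) : walk_det F 0 1 (F^~ 0) = cycle_det F.
Proof.
apply: eq_bigr => s _; rewrite mulr1 -cyc_prod_walk; congr (_ * _).
rewrite enum_ordSl rev_cons -cats1 !big_cat /= !big_cons !big_nil porbit_id andbF.
have -> : cyc_min s ord0 by apply/forall_inP.
rewrite !mulr1; congr (_ * _); rewrite -map_rev !big_map.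
apply: eq_bigl => x; case: (boolP (cyc_min s _)) => //= /forall_inP h.
by apply/negP => /h.
Qed.

Section Recursion.
Variables (k : nat) (F : 'M[K]_k.+1) (i : 'I_k.+1).
Let F' : 'M[K]_k := mxsub (lift i) (lift i) F.

Lemma walk_lift b y p :
  walk F b (lift i y) (map (lift i) p) = walk F' (b \o lift i) y p.
Proof. by elim: p y => //= z p IH y; rewrite IH mxE. Qed.

Lemma cyc_prod_splice (t : 'S_k) x y : x \notin map (lift i) (fingraph.orbit t y) ->
  cyc_prod F (splice i t x) (lift i y) = cyc_prod F' t y.
Proof.
move=> h; rewrite !cyc_prod_walk /cycle_tail splice_orbit // behead_map walk_lift.
by apply: walk_eq => // u _; rewrite /= mxE.
Qed.

Lemma cyc_min_splice (t : 'S_k) x y : x \notin map (lift i) (fingraph.orbit t y) ->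
  cyc_min (splice i t x) (lift i y) = cyc_min t y.
Proof.
move=> h; rewrite !cyc_min_orbit splice_orbit // all_map; apply: eq_all => z /=.
by rewrite leq_bump2.
Qed.

Lemma big_enum_lift (P : pred 'I_k.+1) (G : 'I_k.+1 -> K) : P i = false ->
  \prod_(x <- rev (enum 'I_k.+1) | P x) G x =
  \prod_(y <- rev (enum 'I_k) | P (lift i y)) G (lift i y).
Proof.
move=> Pi; rewrite -[RHS](big_map (lift i) P G) map_rev -filter_enum_lift.
rewrite -[in RHS]filter_rev [RHS]big_filter_cond; apply: eq_bigl => x.
by case: eqP => [->|]; rewrite ?Pi.
Qed.

(** Permutations are sorted by the image of [i]. A fixed point leaves a permutation of the rest;
    otherwise [i] is cut out of its cycle, its outgoing edge joins [w] and the sign flips. The shape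
    is that of [cofE]. *)
Lemma walk_det_rec w b :
  walk_det F i w b = cycle_det F' * w * b i
    - \sum_(x < k) walk_det F' x (w * F i (lift i x)) (b \o lift i).
Proof.
rewrite /walk_det (reindex _ (onW_bij _ (splice_bij i))) /=.
rewrite -(pair_bigA _ (fun x t => (-1) ^+ splice i t x *
    (\prod_(z <- rev (enum 'I_k.+1) | cyc_min (splice i t x) z &&
       (i \notin porbit (splice i t x) z)) cyc_prod F (splice i t x) z *
     w * walk F b i (cycle_tail (splice i t x) i)))) /=.
rewrite (bigD1_ord i) //=; congr (_ + _).
  rewrite /cycle_det !mulr_suml; apply: eq_bigr => t _.
  rewrite sign_splice eqxx /= /cycle_tail splice_orbit_fix /= !mulrA.
  congr (_ * _ * _ * _); rewrite big_enum_lift ?porbit_id ?andbF //.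
  have ni y : i \notin map (lift i) (fingraph.orbit t y).
    by apply/mapP => -[z _ /eqP]; rewrite (negbTE (neq_lift _ _)).
  apply: eq_big => [y|y _]; last exact: cyc_prod_splice.
  by rewrite cyc_min_splice // mem_porbit_orbit splice_orbit_id ni andbT.
rewrite -sumrN; apply: eq_bigr => x _; rewrite -sumrN; apply: eq_bigr => t _.
rewrite sign_splice [_ == i]eq_sym neq_lift signr_addb expr1 mulN1r mulNr.
congr (- (_ * _)); rewrite /cycle_tail splice_orbit_head /= orbit_cons /=.
rewrite walk_lift !mulrA; congr (_ * _ * _ * _).
have hx y : (lift i x \in map (lift i) (fingraph.orbit t y)) = (x \in porbit t y).
  by rewrite mem_map ?mem_porbit_orbit //; apply: lift_inj.
have ex y : (i \in porbit (splice i t (lift i x)) (lift i y)) = (x \in porbit t y).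
  rewrite porbit_sym mem_porbit_orbit splice_orbit_head inE.
  rewrite [_ == i]eq_sym (negbTE (neq_lift _ _)) /= mem_map; last exact: lift_inj.
  by rewrite -mem_porbit_orbit porbit_sym.
rewrite big_enum_lift ?porbit_id ?andbF //; apply: eq_big => [y|y /andP[_]].
  rewrite ex; case: (boolP (x \in _)) => xy; rewrite ?andbF // !andbT.
  by apply: cyc_min_splice; rewrite hx.
by rewrite ex => xy; apply: cyc_prod_splice; rewrite hx.
Qed.
End Recursion.

(** Induction on [k], matching [walk_det_rec] with [cofE]; [cycle_det] is then a Moore determinant,
    hence central, and moves past [w]. A general [f] is required since removing an index turns it
    into [f \o lift i]. *)
Lemma walk_det_cof n (H : 'M[K]_n) k (f : 'I_k -> 'I_n) :
  hermitian H -> injective f ->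
  cycle_det (mxsub f f H) = mdet H (f @: 'I_k) /\
  forall i w b, walk_det (mxsub f f H) i w (b \o f) =
    w * \sum_(y in f @: 'I_k) cof H (f @: 'I_k) (f i) y * b y.
Proof.
move=> hH; elim: k f => [|k IH] f finj.
  split=> [|[]//]; rewrite cycle_det0 (_ : f @: 'I_0 = set0) ?mdet0 //.
  by apply/setP => x; rewrite inE; apply/imsetP => -[[]].
set c := f @: 'I_k.+1.
have sub i : (f \o lift i) @: 'I_k = c :\ f i.
  apply/setP => x; rewrite in_setD1.
  apply/imsetP/andP => [[y _ ->]|[xi /imsetP[y _ e]]].
    by split; [rewrite (inj_eq finj) eq_sym neq_lift | apply: imset_f].
  rewrite e (inj_eq finj) in xi; have [z yz|yi] := unliftP i y.
    by exists z; rewrite // e yz.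
  by rewrite yi eqxx in xi.
have wd i w b : walk_det (mxsub f f H) i w (b \o f) =
    w * \sum_(y in c) cof H c (f i) y * b y.
  have inj' : injective (f \o lift i) by apply: inj_comp finj _; apply: lift_inj.
  have [cd wd] := IH _ inj'; rewrite sub in cd.
  have fic : f i \in c by apply: imset_f.
  rewrite walk_det_rec -mxsub_comp cd (mdet_central hH).
  under eq_bigr => x _ do rewrite (wd x _ b) sub mxE.
  transitivity (w * (mdet H (c :\ f i) * b (f i)
    - \sum_(z in c :\ f i) \sum_(y in c :\ f i)
        H (f i) z * cof H (c :\ f i) z y * b y)).
    rewrite mulrBr mulrA; congr (_ - _); rewrite -sub big_imset /=; last first.
      by move=> ? ? _ _ /inj'.
    rewrite mulr_sumr; apply: eq_bigr => x _; rewrite -mulrA; congr (w * _).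
    by rewrite mulr_sumr; apply: eq_bigr => y _; rewrite mulrA.
  congr (w * _); rewrite [RHS](bigD1 (f i)) //= cof_diag //; congr (_ + _).
  rewrite exchange_big -sumrN; apply: eq_big => [y|y]; first by rewrite !inE andbC.
  case/setD1P=> yi _; rewrite cofE // eq_sym (negbTE yi) mul0r sub0r mulNr.
  by rewrite mulr_suml.
split=> //; have -> : cycle_det (mxsub f f H) =
    walk_det (mxsub f f H) 0 1 ((fun x => H x (f 0)) \o f).
  rewrite -cdet_cycle_det; congr (walk_det _ _ _ _).
  by apply/funext => u; rewrite mxE.
by rewrite wd mul1r cof_mul ?imset_f // eqxx mul1r.
Qed.
End DeterminantRecursion.

(** * Row determinants by conjugation, and principal submatrices *)

Section RowDeterminant.
Variable R : realType.
Local Notation K := (quat R).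

Lemma qconj_prod (I : Type) (r : seq I) (P : pred I) (F : I -> K) :
  qconj (\prod_(i <- r | P i) F i) = \prod_(i <- rev r | P i) qconj (F i).
Proof.
elim: r => [|x r IH]; first by rewrite !big_nil qconj1.
rewrite rev_cons -cats1 big_cat !big_cons big_nil /=.
by case: ifP => _; rewrite ?mulr1 // qconjM IH.
Qed.

Lemma qconj_prod_ord d (g : nat -> K) :
  qconj (\prod_(l < d) g l) = \prod_(l < d) qconj (g (d - l.+1)%N).
Proof.
elim: d => [|d IH]; first by rewrite !big_ord0 qconj1.
rewrite big_ord_recr qconjM big_ord_recl /= subSS subn0 IH; congr (_ * _).
Qed.

(** Conjugation reverses the product, so the cycle is run backwards from the same point: a cycle of
    [s^-1]. *)
Lemma qconj_cyc_prod n (F : 'M[K]_n) (s : 'S_n) x :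
  qconj (cyc_prod (adjq F) s x) = cyc_prod F s^-1 x.
Proof.
rewrite /cyc_prod porbitV; set d := #|porbit s x|.
rewrite (qconj_prod_ord d (fun l => adjq F ((s ^+ l)%g x) ((s ^+ l.+1)%g x))).
have back l : (l <= d)%N -> (s^-1 ^+ l)%g x = (s ^+ (d - l))%g x.
  move=> ld; have {1}<- : (s ^+ d)%g x = x by rewrite permX iter_porbit.
  by rewrite -{1}(subnK ld) expgD permM expgVn permK.
apply: eq_bigr => l _; rewrite mxE qconjK -subSn // subSS.
by rewrite !back // ltnW.
Qed.

Lemma rdet_cdet n (F : 'M[K]_n) i : rdet i F = qconj (cdet i (adjq F)).
Proof.
rewrite /cdet qconj_sum /rdet (reindex_inj (@invg_inj _)); apply: eq_bigr => s _ /=.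
rewrite porbitsV !qconjM qconj_cyc_prod qconj_prod revK !sign_porbits.
have -> : qconj ((-1) ^+ s) = (-1) ^+ s :> K.
  by case: (odd_perm s); rewrite ?expr0 ?expr1 ?raddfN /= qconj1.
rewrite commr_sign; congr (_ * (_ * _)); apply: eq_big => x.
  by rewrite porbitV /cyc_min porbitV.
by rewrite qconj_cyc_prod.
Qed.

Section PrincipalSubmatrices.
Variables (n : nat) (H : 'M[K]_n).
Hypothesis hH : hermitian H.
Implicit Types b : {set 'I_n}.

Lemma imset_enum_val b : (enum_val : 'I_#|b| -> 'I_n) @: 'I_#|b| = b.
Proof.
apply/setP => x; apply/imsetP/idP => [[y _ ->]|xb]; first exact: enum_valP.
by exists (enum_rank_in xb x); rewrite ?enum_rankK_in.
Qed.

Lemma cdet_psub b (i : 'I_#|b|) (v : 'cV[K]_n) :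
  cdet i (colrep (psub H b) i (\col_x v (enum_val x) 0)) =
  \sum_(y in b) cof H b (enum_val i) y * v y 0.
Proof.
have [_ wd] := walk_det_cof hH (@enum_val_inj _ (mem b)).
have := wd i 1 (v^~ 0); rewrite mul1r imset_enum_val => <-.
rewrite cdet_colrep; congr (walk_det _ _ _ _).
by apply/funext => x; rewrite mxE.
Qed.

Lemma cdet_sub_colrep b i (v : 'cV[K]_n) : i \in b ->
  cdet_sub (colrep H i v) b i = \sum_(y in b) cof H b i y * v y 0.
Proof.
(* Since [i] lies in [b], its position in [enum b] is below [#|b|] and the default 0 is not
   reached. *)
move=> ib; rewrite /cdet_sub; case: insubP => [x _ xE|]; last first.
  by rewrite cardE index_mem mem_enum ib.
have vx : enum_val x = i.
  by rewrite (enum_val_nth i) xE nth_index // mem_enum.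
rewrite -[in RHS]vx -cdet_psub; congr (cdet _ _); apply/matrixP => u w.
by rewrite !mxE -(inj_eq (@enum_val_inj _ (mem b))) vx.
Qed.

Lemma psub_herm b : hermitian (psub H b).
Proof. by apply/hermitianP => x y; rewrite !mxE; apply: (hermitianP H).1. Qed.

(** A matrix is unchanged when a column is replaced by itself, so [cdet_psub] and [cof_mul] apply;
    on the empty set both sides are 1. *)
Lemma pminor_mdet b : pminor H b = mdet H b.
Proof.
rewrite /pminor /hdet; case: insubP => [x _ _|]; last first.
  by rewrite -leqNgt leqn0 cards_eq0 => /eqP->; rewrite mdet0.
rewrite rdet_cdet psub_herm.
have {1}-> : psub H b =
    colrep (psub H b) x (\col_u (col (enum_val x) H) (enum_val u) 0).
  by apply/matrixP => u w; rewrite !mxE; case: eqP => // ->.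
rewrite cdet_psub -(mdet_conj hH); congr qconj.
have xb : enum_val x \in b by apply: enum_valP.
transitivity (\sum_(y in b) cof H b (enum_val x) y * H y (enum_val x)).
  by apply: eq_bigr => y _; rewrite mxE.
by rewrite cof_mul // eqxx mul1r.
Qed.

Lemma rdet_sub_rowrep b i (v : 'rV[K]_n) :
  rdet_sub (rowrep H i v) b i = qconj (cdet_sub (colrep H i (adjq v)) b i).
Proof.
rewrite /rdet_sub /cdet_sub; case: insubP => [x _ _|]; last by rewrite raddf0.
rewrite rdet_cdet; congr (qconj (cdet _ _)); apply/matrixP => u w; rewrite !mxE.
by case: eqP => _; rewrite // (hermitianP H).1.
Qed.

Lemma sum_pminor k :
  \sum_(b : {set 'I_n} | #|b| == k) pminor H b = mdet_sum H k.
Proof. by apply: eq_bigr => b _; rewrite pminor_mdet. Qed.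

Lemma sum_cdet_sub k i (v : 'cV[K]_n) :
  \sum_(b : {set 'I_n} | (#|b| == k) && (i \in b)) cdet_sub (colrep H i v) b i
  = (cof_sum H k *m v) i 0.
Proof.
rewrite mxE; under [RHS]eq_bigr => y _ do rewrite mxE mulr_suml.
rewrite exchange_big; apply: eq_bigr => b /andP[_ ib] /=.
rewrite cdet_sub_colrep // big_mkcond; apply: eq_bigr => y _.
by case: ifPn => // yb; rewrite cof_notin ?mul0r.
Qed.

Lemma sum_rdet_sub k i (v : 'rV[K]_n) :
  \sum_(b : {set 'I_n} | (#|b| == k) && (i \in b)) rdet_sub (rowrep H i v) b i
  = (v *m cof_sum H k) 0 i.
Proof.
under eq_bigr => b _ do rewrite rdet_sub_rowrep.
rewrite -qconj_sum sum_cdet_sub -[v in RHS]adjqK.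
by rewrite -[in RHS](cof_sum_herm hH k) -adjqM [RHS]mxE.
Qed.
End PrincipalSubmatrices.

Lemma is_mpinv_adjq m n (A : 'M[K]_(m, n)) X :
  is_mpinv A X -> is_mpinv (adjq A) (adjq X).
Proof.
case=> AXA XAX AXh XAh; split.
- by rewrite -!adjqM mulmxA AXA.
- by rewrite -!adjqM mulmxA XAX.
- by rewrite -adjqM XAh.
- by rewrite -adjqM AXh.
Qed.

Lemma cof_sum_mpinv m n (A : 'M[K]_(m, n)) : exists2 d : R, 0 < d &
  mdet_sum (adjq A *m A) (qrank A) = qreal d /\
  cof_sum (adjq A *m A) (qrank A) *m adjq A = qreal d *: mpinv A.
Proof.
have [d d0 e] := mdet_sum_rank A; exists d => //; split=> //.
exact: (mpinv_cof_sum (@mdet_sum_gt_rank _ _ _ A) e (mpinvP A)).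
Qed.

(** The column version for [adjq B], read through the adjoint; [qrank_adj] identifies the ranks. *)
Lemma mpinv_cof_sum_row m n (B : 'M[K]_(m, n)) : exists2 d : R, 0 < d &
  mdet_sum (B *m adjq B) (qrank B) = qreal d /\
  adjq B *m cof_sum (B *m adjq B) (qrank B) = qreal d *: mpinv B.
Proof.
have [d d0 e] := mdet_sum_rank (adjq B).
have gt := @mdet_sum_gt_rank _ _ _ (adjq B).
have := mpinv_cof_sum gt e (is_mpinv_adjq (mpinvP B)).
rewrite !adjqK qrank_adj in e * => c; exists d => //; split=> //.
have hBB : hermitian (B *m adjq B) by rewrite /hermitian adjqM adjqK.
by rewrite -(cof_sum_herm hBB) -adjqM c adjqZ adjqK.
Qed.
End RowDeterminant.

(** * Determinantal formulas for the entries of [X1] and [X2] *)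

Lemma mulmx_col (K : pzRingType) m n p (A : 'M[K]_(m, n)) (B : 'M_(n, p)) j :
  A *m col j B = col j (A *m B).
Proof. by rewrite !colE mulmxA. Qed.

Theorem theorem4p2 (R : realType) (m n p q s r1 r2 r3 r4 : nat)
  (A1 : 'M[quat R]_(m, n)) (A2 : 'M[quat R]_(m, p))
  (B2 : 'M[quat R]_(q, s)) (C : 'M[quat R]_(m, s)) :
  qrank A1 = r1 -> qrank A2 = r2 -> qrank B2 = r3 ->
  let M := RA A1 *m A2 in
  qrank M = minn (qrank A2) (qrank (RA A1)) -> qrank M = r4 ->
  let X1 := mpinv A1 *m C - mpinv A1 *m A2 *m mpinv M *m C in
  let X2 := mpinv M *m C *m mpinv B2 in
  let A2t := adjq A1 *m A2 in
  let C1 := adjq A1 *m C in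
  let C2 := adjq M *m C in
  let C3 := adjq M *m C *m adjq B2 in
  let AA := adjq A1 *m A1 in
  let MM := adjq M *m M in
  let BB := B2 *m adjq B2 in
  let dA := \sum_(b : {set 'I_n} | #|b| == r1) pminor AA b in
  let dM := \sum_(b : {set 'I_p} | #|b| == r4) pminor MM b in
  let dB := \sum_(a : {set 'I_q} | #|a| == r3) pminor BB a in
  let dB2 := fun f : 'I_q => \col_(k < p)
      \sum_(a : {set 'I_q} | (#|a| == r3) && (f \in a))
         rdet_sub (rowrep BB f (row k C3)) a f in
  let dMg := fun g : 'I_p => \row_(l < q)
      \sum_(b : {set 'I_p} | (#|b| == r4) && (g \in b))
         cdet_sub (colrep MM g (col l C3)) b g in
  (forall (i : 'I_n) (j : 'I_s),
     X1 i j =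
       (\sum_(b : {set 'I_n} | (#|b| == r1) && (i \in b))
           cdet_sub (colrep AA i (col j C1)) b i) * qinv dA
     - (\sum_(t < p)
          (\sum_(b : {set 'I_n} | (#|b| == r1) && (i \in b))
              cdet_sub (colrep AA i (col t A2t)) b i)
          * (\sum_(b : {set 'I_p} | (#|b| == r4) && (t \in b))
              cdet_sub (colrep MM t (col j C2)) b t))
       * qinv (dA * dM))
  /\
  (forall (g : 'I_p) (f : 'I_q),
     X2 g f =
       (\sum_(b : {set 'I_p} | (#|b| == r4) && (g \in b))
           cdet_sub (colrep MM g (dB2 f)) b g) * qinv (dM * dB)
     /\
     X2 g f =
       (\sum_(a : {set 'I_q} | (#|a| == r3) && (f \in a))
           rdet_sub (rowrep BB f (dMg g)) a f) * qinv (dM * dB)).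
Proof.
move=> hA1 _ hB2 M _ hM X1 X2 A2t C1 C2 C3 AA MM BB dA dM dB dB2 dMg.
have hAA : hermitian AA by apply: adjq_gram.
have hMM : hermitian MM by apply: adjq_gram.
have hBB : hermitian BB by rewrite /hermitian adjqM adjqK.
have [a a0 [dAE eA]] := cof_sum_mpinv A1; rewrite hA1 -/AA in dAE eA.
have [c c0 [dME eM]] := cof_sum_mpinv M; rewrite hM -/MM in dME eM.
have [d d0 [dBE eB]] := mpinv_cof_sum_row B2; rewrite hB2 -/BB in dBE eB.
rewrite -sum_pminor // -/dA in dAE; rewrite -sum_pminor // -/dM in dME.
rewrite -sum_pminor // -/dB in dBE.
have qK u x : u != 0 -> qreal u * x * qinv (qreal u) = x :> quat R.
  by move=> u0; rewrite qreal_comm qinv_real // -mulrA -qrealM divff // mulr1.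
(* All numerators have one shape: a real denominator times an entry of a product with a
   Moore-Penrose inverse. [Y] is left free so that the nested sums are covered too. *)
have sumA k i (j : 'I_k) (Y : 'M_(m, k)) :
    \sum_(b : {set 'I_n} | (#|b| == r1) && (i \in b))
      cdet_sub (colrep AA i (col j (adjq A1 *m Y))) b i =
    qreal a * (mpinv A1 *m Y) i j.
  by rewrite sum_cdet_sub // mulmx_col mulmxA eA -scalemxAl !mxE.
have sumM k i (j : 'I_k) (Y : 'M_(m, k)) :
    \sum_(b : {set 'I_p} | (#|b| == r4) && (i \in b))
      cdet_sub (colrep MM i (col j (adjq M *m Y))) b i =
    qreal c * (mpinv M *m Y) i j.
  by rewrite sum_cdet_sub // mulmx_col mulmxA eM -scalemxAl !mxE.
have sumB k i (j : 'I_k) (Y : 'M_(k, s)) :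
    \sum_(b : {set 'I_q} | (#|b| == r3) && (i \in b))
      rdet_sub (rowrep BB i (row j (Y *m adjq B2))) b i =
    qreal d * (Y *m mpinv B2) j i.
  by rewrite sum_rdet_sub // -row_mul -mulmxA eB scaleqAr !mxE.
split=> [i j|g f].
  rewrite dAE dME -qrealM /C1 sumA qK ?gt_eqF // /X1.
  rewrite -[_ *m mpinv M *m C]mulmxA [LHS]mxE [in X in _ + X]mxE; congr (_ - _).
  under [X in _ = X * _]eq_bigr => t _.
    rewrite /A2t /C2 sumA sumM mulrA -[_ * _ * qreal c]mulrA -qreal_comm.
    rewrite mulrA -qrealM -mulrA; over.
  rewrite -mulr_sumr qK ?gt_eqF ?mulr_gt0 //.
  by rewrite mxE.
have ZE u (Z : 'M[quat R]_(p, q)) x y : (qreal u *: Z) x y = qreal u * Z x y.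
  by rewrite mxE.
have cd0 : c * d != 0 by rewrite gt_eqF ?mulr_gt0.
rewrite dME dBE -qrealM; split.
  (* The inner row determinants have already produced [mpinv B2] up to the factor [d], so the outer
     sum is again an instance of [sumM]. *)
  have -> : dB2 f = col f (adjq M *m (qreal d *: (C *m mpinv B2))).
    apply/matrixP => k o; rewrite ord1 mxE sumB scaleqAr [RHS]mxE [RHS]mxE.
    by rewrite mulmxA.
  by rewrite sumM scaleqAr ZE mulrA -qrealM qK // /X2 mulmxA.
(* The same in the other order: [mpinv M] is produced first, with the factor [c], and [sumB] handles
   the outer sum. *)
have -> : dMg g = row g ((qreal c *: (mpinv M *m C)) *m adjq B2).
  apply/matrixP => o l; rewrite ord1 mxE /C3 -mulmxA sumM -scalemxAl [RHS]mxE [RHS]mxE.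
  by rewrite mulmxA.
by rewrite sumB -scalemxAl ZE mulrA -qrealM [d * c]mulrC qK.
Qed.
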